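(* Let $(l_j)_{j=1}^\infty$ be a summable sequence of positive numbers and $(\phi_j)_{j=1}^\infty$ a sequence of real numbers. Let $H$ be the Hamburger Hamiltonian with these lengths and angles, and let $W_H$ be its monodromy matrix. Let $\psi\in\mathbb R$ and let $d_l,d_\phi,c_l,c_\phi:[1,\infty)\to(0,\infty)$ be measurable and nonincreasing, with $d_\phi\le 1$ and $c_\phi\le c_l$. Assume that $$\forall j\in\mathbb N:\quad l_j\le d_l(j)\ \wedge\ |\sin(\phi_{j+1}-\phi_j)|\le d_\phi(j),$$ $$\forall N\in\mathbb N:\quad \sum_{j=N+1}^\infty l_j\le c_l(N)\ \wedge\ \sum_{j=N+1}^\infty l_j\sin^2(\phi_j-\psi)\le c_\phi(N).$$ Let $h(R)$ and $\mathfrak g(t,R)$ be the functions built from $d_l,d_\phi$ as in the context. With $m=m(t,R):=\min\{\lceil t\rceil,\lfloor h(R)\rfloor\}$ set $$L(t,R):=1+\log^+R+\log^+\frac{c_l(\lceil t\rceil)}{c_\phi(\lceil t\rceil)}+\log^+\frac{d_l(1)}{d_\phi(1)}+\log^+\frac{d_l(m)}{d_\phi(m)}+\sum_{j=1}^{m-1}\left|\log\left(\frac{d_\phi(j)}{d_l(j)}\Big/\frac{d_\phi(j+1)}{d_l(j+1)}\right)\right|.$$ Then for all $R\ge \frac{2}{d_l(1)d_\phi(1)}$, $$\log\Big(\max_{|z|=R}\|W_H(z)\|\Big)\le 9\cdot\inf_{t\ge1}\Big(\max\Big\{\mathfrak g(t,R),\,R\,(c_lc_\phi)^{\frac12}(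t)\Big\}+L(t,R)\Big).$$
   Context: Hamburger Hamiltonian: for $\phi\in\mathbb R$ let $\xi_\phi:=(\cos\phi,\sin\phi)^T$. Put $x_0:=0$, $x_j:=\sum_{i=1}^jl_i$, $\mathcal L:=\sum_{j=1}^\infty l_j<\infty$. The Hamburger Hamiltonian with lengths $l_j$ and angles $\phi_j$ is $H:(0,\mathcal L)\to\mathbb R^{2\times2}$, $H(t):=\xi_{\phi_j}\xi_{\phi_j}^T$ for $x_{j-1}\le t<x_j$, $j\in\mathbb N=\{1,2,\dots\}$. Monodromy matrix: let $J:=\begin{pmatrix}0&-1\\1&0\end{pmatrix}$. The fundamental solution $W(t;z)$, $t\in[0,\mathcal L]$, $z\in\mathbb C$, is the unique (absolutely continuous in $t$) $2\times2$-matrix solution of $\frac{\partial}{\partial t}W(t;z)J=zW(t;z)H(t)$ for a.e. $t\in(0,\mathcal L)$, $W(0;z)=I$; the monodromy matrix is $W_H(z):=W(\mathcal L;z)$. $\|\cdot\|$ is the operator norm induced by the Euclidean norm. Functions built from $d_l,d_\phi$: for measurable $d_l:[1,\infty)\to(0,\infty)$, $d_\phi:[1,\infty)\to(0,1]$, both bounded and bounded away from $0$ on compact subsets of $[1,\infty)$, set $$k(R):=\sup\Big\{t\in[1,\infty):\sup_{1\le s\le t}\frac{2}{R\,d_l(s)d_\phi(s)}\le1\Big\},\qquad h(R):=\sup\Big\{t\in[1,\infty):\sup_{1\le s\le t}\frac{d_\phi(s)}{R\,d_l(s)}\le1\Big\}$$ (values in $[1,\infty]$) for $R\ge\frac2{d_l(1)d_\phi(1)}$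 and $R\ge\frac{d_\phi(1)}{d_l(1)}$, respectively. One has $k(R)\le h(R)$. For $t\in[1,\infty)$, $R\ge\frac2{d_l(1)d_\phi(1)}$ put $$g(t,R):=\begin{cases}\log\big(R\,d_l(t)d_\phi(t)\big)&1\le t<k(R),\\ R^{1/2}(d_l(t)d_\phi(t))^{1/2}&k(R)\le t<h(R),\\ R\,d_l(t)&h(R)\le t,\end{cases}\qquad \mathfrak g(t,R):=\int_1^tg(s,R)\,ds.$$ $\log^+x:=\max\{\log x,0\}$; products of functions are pointwise, $(fg)(t)=f(t)g(t)$. *)

(* Defs.v *)
From HB Require Import structures.
From mathcomp Require Import all_boot all_order all_algebra.
From mathcomp Require Import all_classical all_reals all_analysis.
From mathcomp Require Import complex.

Set Implicit Arguments.
Unset Strict Implicit.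
Unset Printing Implicit Defensive.

Import Order.TTheory GRing.Theory Num.Theory.
Import numFieldNormedType.Exports.

Local Open Scope classical_set_scope.
Local Open Scope ring_scope.
Local Open Scope complex_scope.

Definition cnorm {R : realType} (z : R[i]) : R := ComplexField.Normc.normc z.

Definition eucl_norm {R : realType} {n : nat} (x : 'cV[R[i]]_n) : R :=
  Num.sqrt (\sum_(i < n) cnorm (x i 0) ^+ 2).

Definition op_norm {R : realType} {n : nat} (A : 'M[R[i]]_n) : R :=
  sup [set eucl_norm (A *m x) | x in [set x : 'cV[R[i]]_n | eucl_norm x <= 1]].

(* The intervals ]u i, v i[ are required to be pairwise disjoint. *)
Definition abs_continuous {R : realType} (a b : R) (f : R -> R[i]) : Prop :=
  forall e : R, 0 < e -> exists2 d : R, 0 < d &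
    forall (n : nat) (u v : 'I_n -> R),
      (forall i, [/\ a <= u i, u i <= v i & v i <= b]) ->
      (forall i j, i != j -> v i <= u j \/ v j <= u i) ->
      \sum_(i < n) (v i - u i) < d ->
      \sum_(i < n) cnorm (f (v i) - f (u i)) < e.

Definition is_cderive {R : realType} (f : R -> R[i]) (t : R) (f' : R[i]) : Prop :=
  is_derive t (1 : R) (fun s => complex.Re (f s)) (complex.Re f') /\
  is_derive t (1 : R) (fun s => complex.Im (f s)) (complex.Im f').

Definition xi_vec {R : realType} (phi : R) : 'cV[R]_2 :=
  \col_(i < 2) (if i == 0 then cos phi else sin phi).

(* Sequences are indexed from 1; the value at index 0 is never used. *)
Definition partial_length {R : realType} (l : nat -> R) (j : nat) : R :=
  \sum_(1 <= i < j.+1) l i.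

Definition total_length {R : realType} (l : nat -> R) : R :=
  fine (\sum_(1 <= j <oo) (l j)%:E)%E.

(* For 0 < t < total_length l the selected index j is unique; the default
   index 1 only matters for t outside [0, total_length l[. *)
Definition hamburger_hamiltonian {R : realType} (l phi : nat -> R) (t : R) : 'M[R]_2 :=
  let j := xget 1%N [set j : nat | (0 < j)%N /\
                       partial_length l j.-1 <= t < partial_length l j] in
  xi_vec (phi j) *m (xi_vec (phi j))^T.

Definition Jmx {R : realType} : 'M[R[i]]_2 :=
  \matrix_(i < 2, j < 2) ((j < i)%N%:R - (i < j)%N%:R).

(* Only the values W t z with 0 <= t <= ell are constrained. *)
Definition fundamental_solution {R : realType} (ell : R) (H : R -> 'M[R]_2)
    (W : R -> R[i] -> 'M[R[i]]_2) : Prop :=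
  forall z : R[i],
  [/\ W 0 z = 1%:M,
      forall i j, abs_continuous 0 ell (fun t => W t z i j) &
      {ae @lebesgue_measure R, forall t : R, 0 < t < ell ->
        exists2 D : 'M[R[i]]_2,
          forall i j, is_cderive (fun s => W s z i j) t (D i j) &
          D *m Jmx = z *: (W t z *m map_mx (real_complex R) (H t))}].

Section growth_functions.
Context {R : realType}.
Implicit Types (dl dphi cl cphi : R -> R) (r t : R).

Definition k_growth dl dphi r : \bar R :=
  ereal_sup [set t%:E | t in [set t : R | 1 <= t /\
    (ereal_sup [set (2 / (r * dl s * dphi s))%:E | s in `[1%R, t]] <= 1)%E]].

Definition h_growth dl dphi r : \bar R :=
  ereal_sup [set t%:E | t in [set t : R | 1 <= t /\
    (ereal_sup [set (dphi s / (r * dl s))%:E | s in `[1%R, t]] <= 1)%E]].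

Definition g_growth dl dphi t r : R :=
  if (t%:E < k_growth dl dphi r)%E then ln (r * dl t * dphi t)
  else if (t%:E < h_growth dl dphi r)%E then Num.sqrt r * Num.sqrt (dl t * dphi t)
  else r * dl t.

Definition g_integral dl dphi t r : \bar R :=
  (\int[@lebesgue_measure R]_(s in `[1%R, t]) (g_growth dl dphi s r)%:E)%E.

Definition lnplus (x : R) : R := Num.max (ln x) 0.

Definition nceil t : nat := `|Num.ceil t|%N.

(* min(ceil t, floor (h r)), where h r lies in [1, +oo]. *)
Definition m_index dl dphi t r : nat :=
  match h_growth dl dphi r with
  | x%:E%E => minn (nceil t) (Num.truncn x)
  | +oo%E => nceil t
  | -oo%E => 0%N
  end.

Definition L_remainder dl dphi cl cphi t r : R :=
  let m := m_index dl dphi t r in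
  let q (j : nat) : R := dphi j%:R / dl j%:R in
  1 + lnplus r + lnplus (cl (nceil t)%:R / cphi (nceil t)%:R)
    + lnplus (dl 1 / dphi 1) + lnplus (dl m%:R / dphi m%:R)
    + \sum_(1 <= j < m) `|ln (q j / q j.+1)|.

End growth_functions.

(* Main.v *)
Require Import Defs.
From HB Require Import structures.
From mathcomp Require Import all_boot all_order all_algebra.
From mathcomp Require Import all_classical all_reals all_analysis.
From mathcomp Require Import measurable_realfun.
From mathcomp Require Import complex ring lra.


(** Write x_j for the partial sums of the lengths.  On ]x_(j-1), x_j[ the
Hamiltonian is constant of rank one and the system reads W' = - W A with
A = z xi xi^T J and A^2 = 0; hence W(x_j) = W(x_(j-1)) (1 - l_j A)
([hamburger_step]), and by continuity the monodromy matrix is the limit of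
the finite products of these transfer matrices.  It is enough to bound all
long finite products by one constant.

Each transfer matrix is looked at in a frame: the rotation by some angle psi
followed by the dilation diag(b, 1).  In the frame of angle psi and scale b
a transfer matrix of length l and angle phi differs from the identity by at
most (3/2) |z| l (cos^2(phi - psi) / b + b sin^2(phi - psi)), and by |z| l / b
when psi = phi.  Passing from the frame of angle phi_j and scale b_j to the
one of angle phi_(j+1) and scale b_(j+1) costs a factor
(1 + b_j |sin(phi_(j+1) - phi_j)|) max(1, b_(j+1) / b_j).  Let R = |z| and
N = ceil(t).  The product is cut into three blocks.

- Head, j <= m, where m is the last integer up to N with d_phi <= R d_l
  throughout [1, m].  The adapted frames with b_j = (R d_l(j) / d_phi(j))^(1/2)
  bound both losses by the same q_j = (R d_l(j) d_phi(j))^(1/2), so the block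
  costs about the product of the (1 + q_j)^2 ([head_bound]).  The ratios of
  consecutive b_j produce the sum of logarithms in L, and b_1 produces the
  terms in R and d_l(1) / d_phi(1).  Moreover 2 log(1 + q_j) <= 3 g(s, R) for
  s in [j - 1, j[, because log(1 + q) <= q always, and 1 + q <= q^3 as soon as
  q^2 >= 2, which holds below k(R).
- Middle, m < j <= N: the trivial bound exp((3/2) R d_l(j)), and R d_l is the
  value of g beyond h(R) ([middle_bound]).
- Tail, j > N: one frame of angle psi and scale (c_l / c_phi)^(1/2) at N makes
  the two tail sums contribute equally, which gives exp(3 R (c_l c_phi)^(1/2))
  ([tail_bound]).

Since g(., R) is compared on [j - 1, j[ with the terms of index j, only the
indices 1, m + 1 and N escape the integral; these are absorbed by L
([total_load_le]).  The constants that come out are all below 9.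

To identify the solution with the product one needs that an absolutely
continuous function whose derivative vanishes almost everywhere is constant
([ac_derivative0_constant]); its proof is a covering argument on the interval. *)

Set Implicit Arguments.
Unset Strict Implicit.
Unset Printing Implicit Defensive.

Import Order.TTheory GRing.Theory Num.Theory.
Import numFieldNormedType.Exports.

Local Open Scope classical_set_scope.
Local Open Scope ring_scope.
Local Open Scope complex_scope.

(** * Absolutely continuous functions with vanishing derivative *)

Lemma cnorm_ge0 (R : realType) (z : R[i]) : 0 <= cnorm z.
Proof. by case: z => a b; exact: sqrtr_ge0. Qed.

Lemma cnorm0 (R : realType) : cnorm (0 : R[i]) = 0.
Proof. exact: ComplexField.Normc.normc0. Qed.

Lemma cnormM (R : realType) (z w : R[i]) : cnorm (z * w) = cnorm z * cnorm w.
Proof. exact: ComplexField.Normc.normcM. Qed.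

Lemma ler_cnormD (R : realType) (z w : R[i]) :
  cnorm (z + w) <= cnorm z + cnorm w.
Proof. exact: le_normcD. Qed.

Lemma cnormN (R : realType) (z : R[i]) : cnorm (- z) = cnorm z.
Proof. exact: normcN. Qed.

Lemma cnorm_real (R : realType) (x : R) : cnorm x%:C = `|x|.
Proof. by rewrite /cnorm /= expr0n /= addr0 sqrtr_sqr. Qed.

Lemma cnorm_le_ReIm (R : realType) (z : R[i]) :
  cnorm z <= `|complex.Re z| + `|complex.Im z|.
Proof.
case: z => a b /=; rewrite /cnorm /=.
rewrite -[leRHS]ger0_norm ?addr_ge0// -sqrtr_sqr ler_wsqrtr//.
rewrite -(real_normK (num_real a)) -(real_normK (num_real b)).
by rewrite sqrrD lerD2r lerDl mulrn_wge0// mulr_ge0.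
Qed.

Lemma derive0_small_increment (R : realType) (g : R -> R) (t e : R) :
  is_derive t (1 : R) g 0 -> 0 < e ->
  exists2 d : R, 0 < d &
    forall x, `|x - t| < d -> `|g x - g t| <= e * `|x - t|.
Proof.
move=> [dg Dg0] e0.
have : (fun h : R => h^-1 *: (g (h *: (1 : R) + t) - g t)) @ (0 : R)^' --> (0 : R).
  by rewrite -[X in _ --> X]Dg0; exact: dg.
move=> /cvgrPdist_le /(_ e e0) [d /= d0 Hd].
exists d => // x xt.
have [->|xt0] := eqVneq x t; first by rewrite !subrr !normr0 mulr0.
have xt0' : x - t != 0 by rewrite subr_eq0.
have := Hd (x - t); rewrite /= sub0r normrN => /(_ xt xt0').
rewrite [_ *: (1 : R)]mulr1 subrK sub0r normrN normrZ normfV.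
by rewrite ler_pdivrMl ?normr_gt0// mulrC.
Qed.

Lemma is_cderive0_small_increment (R : realType) (f : R -> R[i]) (t e : R) :
  is_cderive f t 0 -> 0 < e ->
  exists2 d : R, 0 < d &
    forall x, `|x - t| < d -> cnorm (f x - f t) <= e * `|x - t|.
Proof.
move=> [dr di] e0; have e20 : 0 < e / 2 by rewrite divr_gt0.
have [d1 d10 H1] := derive0_small_increment dr e20.
have [d2 d20 H2] := derive0_small_increment di e20.
exists (Num.min d1 d2); first by rewrite lt_min d10.
move=> x; rewrite lt_min => /andP[/H1 h1 /H2 h2].
apply: (le_trans (cnorm_le_ReIm _)).
rewrite !raddfB /= [e](splitr e) mulrDl; exact: lerD.
Qed.

(** F t is the measure of the part of U in [a, t].  It serves as a monotone
account, never exceeding d, on which intervals contained in U are charged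
their length. *)
Lemma open_content (R : realType) (U : set R) (a d : R) :
  open U -> (lebesgue_measure U < d%:E)%E ->
  exists F : R -> R, [/\ forall t, 0 <= F t < d,
    forall u v, u <= v -> F u <= F v &
    forall u v, a <= u -> u <= v -> `[u, v] `<=` U -> F u + (v - u) <= F v].
Proof.
move=> oU Ud; pose F t := fine (lebesgue_measure (U `&` `[a, t])).
have mU : measurable U by exact: open_measurable.
have mUt t : measurable (U `&` `[a, t]) by exact: measurableI.
have lt_d t : (lebesgue_measure (U `&` `[a, t]) < d%:E)%E.
  by apply: le_lt_trans Ud; apply: le_measure; rewrite ?inE//; exact: mUt.
have fin t : lebesgue_measure (U `&` `[a, t]) \is a fin_num.
  by rewrite ge0_fin_numE// (lt_trans (lt_d t))// ltry.
exists F; split=> [t|u v uv|u v au uv uvU].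
- by rewrite fine_ge0//= -lte_fin fineK// lt_d.
- rewrite fine_le//; apply: le_measure; rewrite ?inE; try exact: mUt.
  by apply: setIS => x /=; rewrite !in_itv/= => /andP[-> /le_trans->].
have -> : v - u = fine (lebesgue_measure (`]u, v] : set R)).
  rewrite lebesgue_measure_itv/= lte_fin; case: ltP => // vu.
  by rewrite /= (@le_anti _ _ u v) ?uv ?vu// subrr.
have fuv : lebesgue_measure (`]u, v] : set R) \is a fin_num.
  by rewrite lebesgue_measure_itv/= ; case: ifP.
rewrite -fineD// fine_le ?fin_numD ?fin// -measureU//.
- apply: le_measure; rewrite ?inE; try exact: mUt.
    by apply: measurableU => //; exact: mUt.
  move=> x [[Ux]|]/=; rewrite !in_itv/=.
    by move=> /andP[-> /le_trans->].
  move=> /andP[ux xv]; split; last by rewrite xv andbT (le_trans au)// ltW.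
  by apply: uvU; rewrite /= in_itv/= xv ltW.
- exact: mUt.
- rewrite -subset0 => x [[_]]/=; rewrite !in_itv/= => /andP[_ xu] /andP[ux _].
  by move: (le_lt_trans xu ux); rewrite ltxx.
Qed.

Lemma negligible_open_cover (R : realType) (D : set R) (e : R) :
  (@lebesgue_measure R).-negligible D -> 0 < e ->
  exists U : set R, [/\ open U, D `<=` U & (lebesgue_measure U < e%:E)%E].
Proof.
pose mu : measure _ _ := @lebesgue_measure R.
move=> [Z [mZ Z0 DZ]] e0.
have Z0' : mu Z = 0%E by exact: Z0.
have [U [oU ZU Ue]] : exists U : set R, [/\ open U, Z `<=` U & (mu (U `\` Z) < e%:E)%E].
  by apply: (@lebesgue_regularity_outer R Z e) => //; rewrite -[X in (X < _)%E]/(mu Z) Z0' ltry.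
exists U; split => //; first exact: subset_trans ZU.
apply: le_lt_trans Ue; have mU := open_measurable oU.
rewrite -[leLHS]/(mu U) -{1}(setDUK ZU).
apply: (@le_trans _ _ (mu Z + mu (U `\` Z))%E); last by rewrite Z0' add0e.
by apply: measureU2 => //; exact: measurableD.
Qed.

(** A local-to-global principle for a compact interval: the supremum of the
points c of [a, b] satisfying Q can be passed, since Q propagates across each
point.  It plays the role of extracting a fine tagged partition. *)
Lemma interval_induction (R : realType) (a b : R) (Q : R -> Prop) :
  a <= b -> Q a ->
  (forall x, a <= x <= b -> exists2 d : R, 0 < d & forall u v,
     a <= u -> u <= x -> x <= v -> v <= b -> x - u < d -> v - x < d ->
     Q u -> Q v) ->
  Q b.
Proof.
move=> ab Qa loc; pose S := [set c | a <= c <= b /\ Q c].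
have Sa : S a by rewrite /S/= lexx ab.
have supS : has_sup S by split; [exists a | exists b => c [/andP[_ ]]].
have ub c : S c -> c <= sup S by exact: ub_le_sup supS.2 _.
have x_ab : a <= sup S <= b.
  rewrite ub//=; apply: ge_sup; first exact: supS.1.
  by move=> c [/andP[_ ]].
have [d d0 Hd] := loc _ x_ab.
have [u [/andP[au ub'] Qu] xu] := sup_adherent d0 supS.
have ux : u <= sup S by apply: ub; rewrite /S/= au ub'.
pose v := Num.min b (sup S + d / 2).
have d20 : 0 < d / 2 by rewrite divr_gt0.
have xv : sup S <= v by rewrite le_min (andP x_ab).2 /= lerDl ltW.
have vb : v <= b by rewrite ge_min lexx.
have Qv : Q v.
  apply: (Hd u v) => //; first by rewrite ltrBlDr -ltrBlDl.
  rewrite ltrBlDl (@le_lt_trans _ _ (sup S + d / 2))//; first by rewrite ge_min lexx orbT.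
  by rewrite ltrD2l [ltRHS](splitr d) ltrDl.
have /ub : S v by rewrite /S/= vb andbT (le_trans _ xv)//; case/andP: x_ab.
rewrite /v ge_min => /orP[bx|].
  suff -> : b = v by [].
  by apply: le_anti; rewrite vb andbT (le_trans bx).
by rewrite gerDl leNgt d20.
Qed.

(** The exceptional null set, together with the end points, is covered by an
open set U of small measure.  Walking from a to b, a step across a point with
zero derivative changes f by at most e times its length; any other point
lies in U, and the step across it is recorded as an interval inside U.  The
recorded intervals are disjoint of small total length, so by absolute
continuity they contribute less than e altogether. *)
Lemma ac_derivative0_constant (R : realType) (a b : R) (f : R -> R[i]) :
  a <= b -> abs_continuous a b f ->
  {ae @lebesgue_measure R, forall t, a < t < b -> is_cderive f t 0} ->
  f b = f a.
Proof.
move=> ab acf aef.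
suff small (e : R) : 0 < e -> cnorm (f b - f a) <= e * (b - a) + e.
  have : cnorm (f b - f a) = 0.
    apply: le_anti; rewrite cnorm_ge0 andbT leNgt; apply/negP => n0.
    have D0 : 0 < b - a + 1 by rewrite ltr_wpDl ?subr_ge0.
    have := small (cnorm (f b - f a) / (b - a + 1) / 2).
    rewrite !divr_gt0// => /(_ isT).
    set c := cnorm _ in n0 *.
    have -> : c / (b - a + 1) / 2 * (b - a) + c / (b - a + 1) / 2 = c / 2.
      by field; rewrite gt_eqF.
    lra.
  by move/ComplexField.Normc.eq0_normc/eqP; rewrite subr_eq0 => /eqP.
move=> e0; have [d d0 acd] := acf e e0.
have [U [oU DU Ud]] : exists U : set R, [/\ open U,
    (~` [set t | a < t < b -> is_cderive f t 0]) `|` ([set a] `|` [set b]) `<=` U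
    & (lebesgue_measure U < d%:E)%E].
  apply: negligible_open_cover => //; apply: negligibleU => //.
  by apply: negligibleU; apply/negligibleP => //; exact: lebesgue_measure_set1.
have [F [Fd Fmono Fitv]] := open_content a oU Ud.
pose Q c := exists n (u v : nat -> R), [/\
  forall i, (i < n)%N -> [/\ a <= u i, u i <= v i & v i <= c],
  forall i j, (i < n)%N -> (j < n)%N -> i != j -> v i <= u j \/ v j <= u i,
  \sum_(i < n) (v i - u i) <= F c &
  cnorm (f c - f a) <= e * (c - a) + \sum_(i < n) cnorm (f (v i) - f (u i))].
suff [n [u [v [uvb disj Fb fb]]]] : Q b.
  apply: (le_trans fb); rewrite lerD2l ltW//; apply: acd.
  - by move=> i; exact: uvb.
  - by move=> i j ij; apply: disj.
  - by apply: le_lt_trans Fb _; case/andP: (Fd b).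
apply: (interval_induction ab).
  exists 0, (fun=> 0), (fun=> 0); split => //.
    by rewrite big_ord0; case/andP: (Fd a).
  by rewrite !subrr mulr0 big_ord0 add0r cnorm0.
move=> x xab; have [Dx|nDx] := pselect (U x).
  have /nbhs_ballP[d1 /= d10 xU] : nbhs x U by apply: open_nbhs_nbhs.
  exists d1 => // p q ap px xq qb pd qd [n [u [v [uvp disj Fp fp]]]].
  have pq : p <= q by exact: le_trans xq.
  have pqU : `[p, q] `<=` U.
    move=> y /=; rewrite in_itv/= => /andP[py yq]; apply: xU.
    rewrite /ball/= ltr_norml; lra.
  have Fpq := Fitv _ _ ap pq pqU.
  exists n.+1, (fun i => if (i < n)%N then u i else p),
    (fun i => if (i < n)%N then v i else q); split.
  - move=> i; rewrite ltnS leq_eqVlt => /orP[/eqP->|lin]; first by rewrite ltnn.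
    by rewrite lin; have [? ? vp] := uvp i lin; split => //; exact: le_trans pq.
  - move=> i j; rewrite !ltnS => li lj ij.
    have [lin|nli] := ltnP i n; have [ljn|nlj] := ltnP j n.
    + exact: disj.
    + by left; have [] := uvp i lin.
    + by right; have [] := uvp j ljn.
    + move: ij; rewrite (_ : i = j) ?eqxx//; apply/eqP.
      by rewrite eqn_leq (leq_trans li)// (leq_trans lj).
  - rewrite big_ord_recr/= ltnn; under eq_bigr do rewrite ltn_ord.
    by apply: le_trans Fpq; rewrite lerD2r.
  - rewrite big_ord_recr/= ltnn; under eq_bigr do rewrite ltn_ord.
    rewrite -[f q](subrK (f p)) -addrA addrC.
    apply: (le_trans (ler_cnormD _ _)); rewrite addrA lerD ?subrK//.
    apply: (le_trans fp); rewrite lerD2r ler_wpM2l ?(ltW e0)//.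
    by rewrite lerB.
have xab' : a < x < b.
  move/andP: xab => [ax xb]; rewrite !lt_neqAle ax xb !andbT.
  by apply/andP; split; apply/eqP => xE; apply: nDx; apply: DU; right; [left|right].
have dfx : is_cderive f x 0.
  by apply: contrapT => nd; apply/nDx/DU; left => /(_ xab').
have [d1 d10 Hd1] := is_cderive0_small_increment dfx e0.
exists d1 => // p q ap px xq qb pd qd [n [u [v [uvp disj Fp fp]]]].
have pq : p <= q by exact: le_trans xq.
have Fpq := Fmono _ _ pq.
exists n, u, v; split => //.
- by move=> i lin; have [? ? vp] := uvp i lin; split => //; exact: le_trans pq.
- exact: le_trans Fpq.
have hp : cnorm (f x - f p) <= e * (x - p).
  by rewrite -cnormN opprB -[x - p]ger0_norm ?subr_ge0// distrC Hd1// distrC ger0_norm ?subr_ge0.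
have hq : cnorm (f q - f x) <= e * (q - x).
  by rewrite -[q - x]ger0_norm ?subr_ge0// Hd1// ger0_norm ?subr_ge0.
have -> : f q - f a = (f q - f x) + ((f x - f p) + (f p - f a)) by ring.
have := ler_cnormD (f q - f x) ((f x - f p) + (f p - f a)).
have := ler_cnormD (f x - f p) (f p - f a).
lra.
Qed.

(** * Linear systems with a nilpotent coefficient *)

Lemma abs_continuousD (R : realType) (a b : R) (f g : R -> R[i]) :
  abs_continuous a b f -> abs_continuous a b g ->
  abs_continuous a b (fun t => f t + g t).
Proof.
move=> acf acg e e0; have e20 : 0 < e / 2 by rewrite divr_gt0.
have [d1 d10 H1] := acf _ e20; have [d2 d20 H2] := acg _ e20.
exists (Num.min d1 d2); first by rewrite lt_min d10.
move=> n u v uv disj; rewrite lt_min => /andP[s1 s2].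
rewrite [ltRHS]splitr.
apply: le_lt_trans (ltrD (H1 _ _ _ uv disj s1) (H2 _ _ _ uv disj s2)).
rewrite -big_split/=; apply: ler_sum => i _.
by rewrite opprD addrACA ler_cnormD.
Qed.

(** Covers multiples of f, and more generally every g whose increments are
controlled by those of f. *)
Lemma abs_continuous_lipschitz (R : realType) (a b K : R) (f g : R -> R[i]) :
  0 <= K -> abs_continuous a b f ->
  (forall u v, u <= v -> cnorm (g v - g u) <= K * cnorm (f v - f u)) ->
  abs_continuous a b g.
Proof.
move=> K0 acf gK e e0.
have [d d0 Hd] := acf (e / (K + 1)) (divr_gt0 e0 (ltr_wpDl K0 ltr01)).
exists d => // n u v uv disj s.
have {Hd} := Hd _ _ _ uv disj s; rewrite ltr_pdivlMr ?ltr_wpDl//.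
apply: le_lt_trans; rewrite mulr_suml; apply: ler_sum => i _.
have [_ uvi _] := uv i; apply: (le_trans (gK _ _ uvi)).
by rewrite mulrC ler_wpM2l ?cnorm_ge0// lerDl.
Qed.

Lemma abs_continuousMr (R : realType) (a b : R) (f : R -> R[i]) (c : R[i]) :
  abs_continuous a b f -> abs_continuous a b (fun t => f t * c).
Proof.
move=> acf; apply: (abs_continuous_lipschitz (cnorm_ge0 c) acf) => u v _.
by rewrite -mulrBl cnormM mulrC.
Qed.

Lemma abs_continuous_affine (R : realType) (a b s : R) (c : R[i]) :
  abs_continuous a b (fun t => (t - s)%:C * c).
Proof.
apply: abs_continuousMr => e e0; exists e => // n u v uv _.
apply: le_lt_trans; apply: ler_sum => i _; have [_ uvi _] := uv i.
rewrite (_ : _ - _ = (v i - u i)%:C); last by rewrite !rmorphB/=; ring.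
by rewrite cnorm_real ger0_norm// subr_ge0.
Qed.

Lemma abs_continuous_sub (R : realType) (a b a' b' : R) (f : R -> R[i]) :
  a <= a' -> b' <= b -> abs_continuous a b f -> abs_continuous a' b' f.
Proof.
move=> aa bb acf e /acf[d d0 Hd]; exists d => // n u v uv; apply: Hd => i.
by have [? ? ?] := uv i; split => //; [exact: le_trans aa _|exact: le_trans bb].
Qed.

Lemma is_cderiveD (R : realType) (f g : R -> R[i]) (t : R) (f' g' : R[i]) :
  is_cderive f t f' -> is_cderive g t g' ->
  is_cderive (fun s => f s + g s) t (f' + g').
Proof.
move=> [fr fi] [gr gi]; split; rewrite raddfD/=.
- rewrite (_ : (fun s => _) =
    (fun s => complex.Re (f s)) \+ (fun s => complex.Re (g s))); last by apply/funext => s; rewrite raddfD.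
  exact: is_deriveD.
- rewrite (_ : (fun s => _) =
    (fun s => complex.Im (f s)) \+ (fun s => complex.Im (g s))); last by apply/funext => s; rewrite raddfD.
  exact: is_deriveD.
Qed.

Lemma is_cderiveMr (R : realType) (f : R -> R[i]) (t : R) (f' c : R[i]) :
  is_cderive f t f' -> is_cderive (fun s => f s * c) t (f' * c).
Proof.
case: c f' => p q [x y] [fr fi]; split.
- rewrite (_ : (fun s => _) = (fun s => p *: complex.Re (f s) - q *: complex.Im (f s))); last first.
    by apply/funext => s; rewrite !/GRing.scale/=; case: (f s) => u v /=; ring.
  rewrite (_ : complex.Re _ = p *: x - q *: y); last by rewrite !/GRing.scale/=/=; ring.
  exact: is_deriveB.
- rewrite (_ : (fun s => _) = (fun s => q *: complex.Re (f s) + p *: complex.Im (f s))); last first.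
    by apply/funext => s; rewrite !/GRing.scale/=; case: (f s) => u v /=; ring.
  rewrite (_ : complex.Im _ = q *: x + p *: y); last by rewrite !/GRing.scale/=/=; ring.
  exact: is_deriveD.
Qed.

Lemma is_cderive_affine (R : realType) (t s : R) (c : R[i]) :
  is_cderive (fun u => (u - s)%:C * c) t c.
Proof.
rewrite -[X in is_cderive _ _ X]mul1r; apply: is_cderiveMr; split => /=.
- have := is_deriveB (is_derive_id t (1 : R)) (is_derive_cst s t (1 : R)).
  by rewrite subr0.
- exact: is_derive_cst.
Qed.

Lemma ae_lebesgue_mono (R : realType) (P Q : R -> Prop) :
  (forall t, P t -> Q t) -> {ae @lebesgue_measure R, forall t, P t} ->
  {ae @lebesgue_measure R, forall t, Q t}.
Proof. by move=> PQ; apply: negligibleS => t /= nQ /PQ. Qed.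

Lemma mx2E (R : realType) (M N : 'M[R[i]]_2) i j :
  (M *m N) i j = M i 0 * N 0 j + M i 1 * N 1 j.
Proof.
by rewrite mxE !big_ord_recl big_ord0 addr0; congr (M i _ * N _ j + M i _ * N _ j); apply/val_inj.
Qed.

(** The solution of W' = - W A on [a, b] when A is nilpotent of order two: then
W A has derivative - W A A = 0, so W' is constant and W is affine.  Arguing
in this order avoids the product rule and products of absolutely continuous
functions. *)
Lemma nilpotent_ode_step (R : realType) (a b : R) (W : R -> 'M[R[i]]_2)
    (A : 'M[R[i]]_2) :
  a <= b -> A *m A = 0 ->
  (forall i j, abs_continuous a b (fun t => W t i j)) ->
  {ae @lebesgue_measure R, forall t, a < t < b ->
     exists2 D : 'M[R[i]]_2, forall i j, is_cderive (fun s => W s i j) t (D i j)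
       & D = - (W t *m A)} ->
  W b = W a *m (1%:M - (b - a)%:C *: A).
Proof.
move=> ab AA acW dW.
have WA_const t : a <= t <= b -> W t *m A = W a *m A.
  case/andP=> at_ tb; apply/matrixP => i j; rewrite !mx2E.
  apply: (ac_derivative0_constant
    (f := fun s => W s i 0 * A 0 j + W s i 1 * A 1 j) at_).
    apply: (abs_continuous_sub (lexx a) tb).
    by apply: abs_continuousD; apply: abs_continuousMr; exact: acW.
  apply: ae_lebesgue_mono dW => s dWs /andP[as_ st].
  have [D dD DE] : exists2 D : 'M[R[i]]_2,
      forall i j, is_cderive (fun s => W s i j) s (D i j) & D = - (W s *m A).
    by apply: dWs; rewrite as_ (lt_le_trans st).
  rewrite [X in is_cderive _ _ X](_ : 0 = D i 0 * A 0 j + D i 1 * A 1 j).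
    by apply: is_cderiveD; apply: is_cderiveMr.
  by rewrite -mx2E DE mulNmx -mulmxA AA mulmx0 oppr0 mxE.
(* W' = - W(a) A almost everywhere, so W(t) + (t - a) W(a) A has zero derivative. *)
suff WE i j : W b i j + (b - a)%:C * (W a *m A) i j = W a i j + (a - a)%:C * (W a *m A) i j.
  rewrite mulmxBr mulmx1 -scalemxAr; apply: (canRL (addrK _)).
  apply/matrixP => i j; rewrite mxE [X in _ + X]mxE WE.
  by rewrite subrr mul0r addr0.
apply: (ac_derivative0_constant (f := fun t => W t i j + (t - a)%:C * (W a *m A) i j) ab).
  by apply: abs_continuousD => //; exact: abs_continuous_affine.
apply: ae_lebesgue_mono dW => s dWs sab; have [D dD DE] := dWs sab.
rewrite [X in is_cderive _ _ X](_ : 0 = D i j + (W a *m A) i j).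
  by apply: is_cderiveD => //; exact: is_cderive_affine.
by rewrite DE WA_const ?mxE ?addNr//; case/andP: sab => /ltW-> /ltW->.
Qed.

(** * The monodromy matrix as an infinite product *)

Lemma partial_lengthS (R : realType) (l : nat -> R) j :
  partial_length l j.+1 = partial_length l j + l j.+1.
Proof. by rewrite /partial_length big_nat_recr. Qed.

Lemma partial_length_le (R : realType) (l : nat -> R) m n :
  (forall j, (0 < j)%N -> 0 < l j) -> (m <= n)%N ->
  partial_length l m <= partial_length l n.
Proof.
move=> l0 mn; rewrite /partial_length (@big_cat_nat _ _ _ m.+1 1 n.+1)//= lerDl.
by rewrite big_nat_cond sumr_ge0// => i; rewrite andbT => /andP[mi _]; rewrite ltW// l0// (leq_ltn_trans _ mi).
Qed.

Lemma total_length_ge (R : realType) (l : nat -> R) n :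
  (forall j, (0 < j)%N -> 0 < l j) -> (\sum_(1 <= j <oo) (l j)%:E < +oo)%E ->
  partial_length l n <= total_length l.
Proof.
move=> l0 loo; rewrite -lee_fin fineK; last first.
  by rewrite ge0_fin_numE// nneseries_ge0// => i i0 _; rewrite lee_fin ltW// l0.
rewrite /partial_length -sumEFin; apply: nneseries_lim_ge => i i0 _.
by rewrite lee_fin ltW// l0.
Qed.

Lemma hamburger_hamiltonianE (R : realType) (l phi : nat -> R) j t :
  (forall j, (0 < j)%N -> 0 < l j) ->
  partial_length l j <= t < partial_length l j.+1 ->
  hamburger_hamiltonian l phi t = xi_vec (phi j.+1) *m (xi_vec (phi j.+1))^T.
Proof.
move=> l0 /andP[jt tj]; rewrite /hamburger_hamiltonian; case: xgetP => [k _ [k0 /andP[kt tk]]|].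
  suff -> : k = j.+1 by [].
  case: k k0 kt tk => // k _ /= kt tk; congr _.+1; apply/eqP; rewrite eqn_leq.
  apply/andP; split; rewrite leqNgt; apply/negP => lt.
    by have := lt_le_trans tj (le_trans (partial_length_le l0 lt) kt); rewrite ltxx.
  by have := lt_le_trans tk (le_trans (partial_length_le l0 lt) jt); rewrite ltxx.
by move=> /(_ j.+1) /= /not_andP[|]//; rewrite jt tj.
Qed.

Definition cxi (R : realType) (phi : R) : 'cV[R[i]]_2 := map_mx (real_complex R) (xi_vec phi).

(** The matrix by which the solution is multiplied over an interval of length
len on which the Hamiltonian has angle phi. *)
Definition transfer (R : realType) (z : R[i]) (len phi : R) : 'M[R[i]]_2 :=
  1%:M - len%:C *: (z *: (cxi phi *m (cxi phi)^T *m Jmx)).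

Lemma mx2P (R : realType) (M N : 'M[R[i]]_2) :
  M 0 0 = N 0 0 -> M 0 1 = N 0 1 -> M 1 0 = N 1 0 -> M 1 1 = N 1 1 -> M = N.
Proof.
move=> E00 E01 E10 E11; apply/matrixP => i j.
have o2 (k : 'I_2) : k = 0 \/ k = 1.
  by case: k => [[|[|//]] k2]; [left|right]; apply/val_inj.
by case: (o2 i) => ->; case: (o2 j) => ->.
Qed.

Lemma cxixiE (R : realType) (phi : R) i j :
  (cxi phi *m (cxi phi)^T) i j = cxi phi i 0 * cxi phi j 0.
Proof. by rewrite mxE big_ord1 [in X in _ * X]mxE. Qed.

Lemma cxi0 (R : realType) (phi : R) : cxi phi 0 0 = (cos phi)%:C.
Proof. by rewrite !mxE. Qed.

Lemma cxi1 (R : realType) (phi : R) : cxi phi 1 0 = (sin phi)%:C.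
Proof. by rewrite !mxE. Qed.

Lemma JmxE (R : realType) :
  [/\ @Jmx R 0 0 = 0, @Jmx R 0 1 = -1, @Jmx R 1 0 = 1 & @Jmx R 1 1 = 0].
Proof. by split; rewrite mxE/= ?subr0 ?sub0r. Qed.

Lemma hamburger_step (R : realType) (l phi : nat -> R) W z j :
  (forall j, (0 < j)%N -> 0 < l j) -> (\sum_(1 <= j <oo) (l j)%:E < +oo)%E ->
  fundamental_solution (total_length l) (hamburger_hamiltonian l phi) W ->
  W (partial_length l j.+1) z =
  W (partial_length l j) z *m transfer z (l j.+1) (phi j.+1).
Proof.
move=> l0 loo /(_ z) [_ acW odeW].
have jj : partial_length l j <= partial_length l j.+1 by exact: partial_length_le.
have j0 : 0 <= partial_length l j.
  by rewrite -[leLHS](_ : partial_length l 0 = 0) ?partial_length_le// /partial_length big_geq.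
have jl := total_length_ge j.+1 l0 loo.
set A := z *: (cxi (phi j.+1) *m (cxi (phi j.+1))^T *m Jmx).
have [J00 J01 J10 J11] := JmxE R.
have := @nilpotent_ode_step R _ _ (fun t => W t z) A jj.
rewrite {1}(_ : partial_length l j.+1 - partial_length l j = l j.+1); last first.
  by rewrite partial_lengthS addrAC subrr add0r.
apply.
- rewrite /A -scalemxAl -scalemxAr.
  rewrite (_ : _ *m _ = 0) ?scaler0//.
  by apply/mx2P; rewrite !mx2E !cxixiE J00 J01 J10 J11 !cxi0 !cxi1 mxE; ring.
- by move=> i k; apply: abs_continuous_sub (acW i k).
apply: ae_lebesgue_mono odeW => t odet /andP[jt tj].
have [|D dD DJ] := odet; first by rewrite (le_lt_trans j0 jt) (lt_le_trans tj jl).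
exists D => //.
have JJ : @Jmx R *m Jmx = - 1%:M.
  by apply/mx2P; rewrite !mx2E ?J00 ?J01 ?J10 ?J11 !mxE/=; ring.
rewrite -[D]mulmx1 -[1%:M]opprK -JJ mulmxN mulmxA DJ; congr (- _).
rewrite (hamburger_hamiltonianE (j := j) phi l0) ?(ltW jt)// /A map_mxM map_trmx.
by rewrite -!scalemxAl -!scalemxAr !mulmxA.
Qed.

(** * Bounds on 2 x 2 complex matrices and their limits *)

Lemma cvg_partial_length (R : realType) (l : nat -> R) :
  (forall j, (0 < j)%N -> 0 < l j) -> (\sum_(1 <= j <oo) (l j)%:E < +oo)%E ->
  partial_length l n @[n --> \oo] --> total_length l.
Proof.
move=> l0 loo.
have l0E n : (1 <= n)%N -> true -> (0 <= (l n)%:E)%E by move=> n0 _; rewrite lee_fin ltW// l0.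
have := @is_cvg_nneseries R (fun j => (l j)%:E) xpredT 1 l0E.
move=> cv; have sfin : (\sum_(1 <= j <oo) (l j)%:E)%E \is a fin_num.
  by rewrite ge0_fin_numE// nneseries_ge0.
have : (\sum_(1 <= j < n) (l j)%:E)%E @[n --> \oo] --> (total_length l)%:E.
  by rewrite fineK//; exact: cv.
rewrite -cvg_shiftS; under eq_fun do rewrite sumEFin.
by move=> /fine_cvg.
Qed.

(** Operator norm at most p, as an inequality, so that products need no
supremum. *)
Definition bounded_by (R : realType) (A : 'M[R[i]]_2) (p : R) :=
  forall x, eucl_norm (A *m x) <= p * eucl_norm x.

Lemma eucl_normE (R : realType) (x : 'cV[R[i]]_2) :
  eucl_norm x = Num.sqrt (cnorm (x 0 0) ^+ 2 + cnorm (x 1 0) ^+ 2).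
Proof.
rewrite /eucl_norm !big_ord_recl big_ord0 addr0; congr (Num.sqrt (_ + cnorm (x _ _) ^+ 2)).
exact/val_inj.
Qed.

Lemma eucl_norm_ge0 (R : realType) (x : 'cV[R[i]]_2) : 0 <= eucl_norm x.
Proof. exact: sqrtr_ge0. Qed.

Lemma ler_sqrt_quadratic (R : realType) (a b p q s t : R) :
  0 <= a -> 0 <= b -> 0 <= p -> 0 <= q -> 0 <= s -> 0 <= t ->
  s <= p * a + q * b -> t <= q * a + p * b ->
  Num.sqrt (s ^+ 2 + t ^+ 2) <= (p + q) * Num.sqrt (a ^+ 2 + b ^+ 2).
Proof.
move=> a0 b0 p0 q0 s0 t0 sle tle.
rewrite -[X in X * _]ger0_norm ?addr_ge0// -sqrtr_sqr -sqrtrM ?sqr_ge0//.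
apply: ler_wsqrtr.
have s2 : s ^+ 2 <= (p * a + q * b) ^+ 2 by rewrite ler_sqr ?nnegrE// addr_ge0 ?mulr_ge0.
have t2 : t ^+ 2 <= (q * a + p * b) ^+ 2 by rewrite ler_sqr ?nnegrE// addr_ge0 ?mulr_ge0.
apply: (le_trans (lerD s2 t2)).
have pq : 0 <= p * q * (a - b) ^+ 2 by rewrite (mulr_ge0 (mulr_ge0 p0 q0)) ?sqr_ge0.
have -> : (p + q) ^+ 2 * (a ^+ 2 + b ^+ 2) =
  (p * a + q * b) ^+ 2 + (q * a + p * b) ^+ 2 + 2 * (p * q * (a - b) ^+ 2) by ring.
by rewrite lerDl mulr_ge0.
Qed.

(** The moduli of the entries are dominated by the matrix with p on the diagonal
and q off it, whose largest eigenvalue is p + q. *)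
Lemma bounded_by_entries (R : realType) (A : 'M[R[i]]_2) (p q : R) :
  cnorm (A 0 0) <= p -> cnorm (A 1 1) <= p ->
  cnorm (A 0 1) <= q -> cnorm (A 1 0) <= q -> bounded_by A (p + q).
Proof.
move=> A00 A11 A01 A10 x; rewrite !eucl_normE.
have E i : (A *m x) i 0 = A i 0 * x 0 0 + A i 1 * x 1 0.
  by rewrite mxE !big_ord_recl big_ord0 addr0; congr (_ + A i _ * x _ _); exact/val_inj.
have row i : cnorm ((A *m x) i 0) <=
    cnorm (A i 0) * cnorm (x 0 0) + cnorm (A i 1) * cnorm (x 1 0).
  by rewrite E (le_trans (ler_cnormD _ _))// !cnormM.
apply: ler_sqrt_quadratic; rewrite ?cnorm_ge0//.
- exact: le_trans (cnorm_ge0 _) A00.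
- exact: le_trans (cnorm_ge0 _) A01.
- by apply: (le_trans (row 0)); rewrite lerD// ler_wpM2r// cnorm_ge0.
- by apply: (le_trans (row 1)); rewrite lerD// ler_wpM2r// cnorm_ge0.
Qed.

Lemma bounded_by_mul (R : realType) (A B : 'M[R[i]]_2) (p q : R) :
  0 <= p -> bounded_by A p -> bounded_by B q -> bounded_by (A *m B) (p * q).
Proof.
move=> p0 Ap Bq x; rewrite -mulmxA (le_trans (Ap _))// -mulrA.
by rewrite ler_wpM2l.
Qed.

Lemma bounded_byW (R : realType) (A : 'M[R[i]]_2) (p q : R) :
  p <= q -> bounded_by A p -> bounded_by A q.
Proof.
by move=> pq Ap x; rewrite (le_trans (Ap x))// ler_wpM2r// eucl_norm_ge0.
Qed.

Lemma op_norm_le (R : realType) (A : 'M[R[i]]_2) (p : R) :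
  0 <= p -> bounded_by A p -> op_norm A <= p.
Proof.
move=> p0 Ap; apply: ge_sup.
  exists (eucl_norm (A *m 0)), 0 => //=.
  by rewrite eucl_normE !mxE cnorm0 expr0n/= addr0 sqrtr0.
move=> _ [x /= x1 <-]; apply: (le_trans (Ap x)).
by rewrite -[leRHS]mulr1 ler_wpM2l.
Qed.

(** Minkowski's inequality in the plane of moduli, obtained as the triangle
inequality for the complex numbers |x_0| + i |x_1| and |y_0| + i |y_1|. *)
Lemma ler_eucl_normD (R : realType) (x y : 'cV[R[i]]_2) :
  eucl_norm (x + y) <= eucl_norm x + eucl_norm y.
Proof.
have triangle (a b c d : R) : Num.sqrt ((a + c) ^+ 2 + (b + d) ^+ 2) <=
    Num.sqrt (a ^+ 2 + b ^+ 2) + Num.sqrt (c ^+ 2 + d ^+ 2).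
  exact: (ler_cnormD (a +i* b) (c +i* d)).
rewrite !eucl_normE !mxE; apply: le_trans (triangle _ _ _ _); apply: ler_wsqrtr.
by apply: lerD; rewrite ler_sqr ?nnegrE ?addr_ge0 ?cnorm_ge0// ler_cnormD.
Qed.

(** Absolute continuity enters only through the continuity of the entries at
the right end point. *)
Lemma bounded_by_limit (R : realType) (V : R -> 'M[R[i]]_2) (b p : R) (u : nat -> R) :
  (forall i j, abs_continuous 0 b (fun t => V t i j)) ->
  (forall n, 0 <= u n <= b) -> u n @[n --> \oo] --> b ->
  (\forall n \near \oo, bounded_by (V (u n)) p) -> bounded_by (V b) p.
Proof.
move=> acV ub cvu Vp x; apply/ler_addgt0Pl => e e0.
pose d := e / (2 * (eucl_norm x + 1)).
have x0 : 0 < eucl_norm x + 1 by rewrite ltr_wpDl ?eucl_norm_ge0.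
have d0 : 0 < d by rewrite divr_gt0// mulr_gt0.
have near_entry i j : \forall n \near \oo, cnorm (V b i j - V (u n) i j) < d.
  have [c c0 Hc] := acV i j d d0.
  have /cvgrPdist_lt/(_ c c0) := cvu; apply: filterS => n.
  have /andP[u0 uleb] := ub n; rewrite ger0_norm ?subr_ge0// => buc.
  have := Hc 1%N (fun=> u n) (fun=> b); rewrite !big_ord1; apply => //.
  by move=> k m; rewrite !ord1.
near \oo => n.
have Vpn : bounded_by (V (u n)) p by near: n; exact: Vp.
have E : bounded_by (V b - V (u n)) (d + d).
  by apply: bounded_by_entries; rewrite !mxE ltW//; near: n; exact: near_entry.
rewrite -[V b](subrK (V (u n))) mulmxDl (le_trans (ler_eucl_normD _ _))//.
apply: lerD (Vpn x); apply: (le_trans (E x)).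
have -> : d + d = e / (eucl_norm x + 1) by rewrite /d; field; rewrite gt_eqF.
by rewrite mulrAC ler_pdivrMr// ler_pM2l// lerDl.
Unshelve. all: by end_near. Qed.

(** * Transfer matrices in rotated and rescaled frames *)

Definition rmx (R : realType) (a b c d : R) : 'M[R[i]]_2 :=
  \matrix_(i < 2, j < 2)
    (if i == 0 then if j == 0 then a else b else if j == 0 then c else d)%:C.

Lemma rmxE (R : realType) (a b c d : R) :
  [/\ rmx a b c d 0 0 = a%:C, rmx a b c d 0 1 = b%:C, rmx a b c d 1 0 = c%:C
    & rmx a b c d 1 1 = d%:C].
Proof. by split; rewrite mxE. Qed.

Lemma rmxM (R : realType) (a b c d a' b' c' d' : R) :
  rmx a b c d *m rmx a' b' c' d' =
  rmx (a * a' + b * c') (a * b' + b * d') (c * a' + d * c') (c * b' + d * d').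
Proof. by apply/mx2P; rewrite mx2E !mxE/= rmorphD !rmorphM. Qed.

Lemma rmx1 (R : realType) : rmx 1 0 0 1 = 1%:M :> 'M[R[i]]_2.
Proof. by apply/mx2P; rewrite !mxE. Qed.

Lemma bounded_by_rmx (R : realType) (a b c d p q : R) :
  `|a| <= p -> `|d| <= p -> `|b| <= q -> `|c| <= q -> bounded_by (rmx a b c d) (p + q).
Proof.
move=> ap dp bq cq; have [E00 E01 E10 E11] := rmxE a b c d.
by apply: bounded_by_entries; rewrite ?E00 ?E01 ?E10 ?E11 cnorm_real.
Qed.

(** The rotation by psi times diag(b, 1).  Only the ratio of the two dilation
factors matters for conjugation, which is why one of them is 1. *)
Definition frame (R : realType) (psi b : R) :=
  rmx (b * cos psi) (- sin psi) (b * sin psi) (cos psi).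
(** The inverse of [frame psi b]. *)
Definition coframe (R : realType) (psi b : R) :=
  rmx (cos psi / b) (sin psi / b) (- sin psi) (cos psi).

Lemma abs_cos_le1 (R : realType) (x : R) : `|cos x| <= 1.
Proof. by rewrite ler_norml cos_geN1 cos_le1. Qed.

Lemma abs_sin_le1 (R : realType) (x : R) : `|sin x| <= 1.
Proof. by rewrite ler_norml sin_geN1 sin_le1. Qed.

Lemma coframe_frame (R : realType) (phi psi b : R) : b != 0 ->
  coframe phi b *m frame psi b =
  rmx (cos (psi - phi)) (- (sin (psi - phi) / b)) (b * sin (psi - phi)) (cos (psi - phi)).
Proof.
move=> b0; rewrite rmxM cosB sinB; congr rmx; by field.
Qed.

Lemma frame_coframe (R : realType) (psi b : R) : b != 0 ->
  frame psi b *m coframe psi b = 1%:M.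
Proof.
move=> b0; rewrite rmxM -rmx1; congr rmx; last first.
- by rewrite -(cos2Dsin2 psi); field.
- by field.
- by field.
- by rewrite -(cos2Dsin2 psi); field.
Qed.

Lemma bounded_by_frame (R : realType) (psi b : R) : 1 <= b ->
  bounded_by (frame psi b) (2 * b).
Proof.
move=> b1; have b0 : 0 <= b by exact: le_trans b1.
rewrite [2 * b](_ : _ = b + b); last by ring.
have bM x : `|x| <= 1 -> `|b * x| <= b.
  by move=> x1; rewrite normrM (ger0_norm b0) ler_piMr.
apply: bounded_by_rmx; rewrite ?normrN ?bM ?abs_cos_le1 ?abs_sin_le1//.
- exact: le_trans (abs_cos_le1 _) b1.
- exact: le_trans (abs_sin_le1 _) b1.
Qed.

Lemma bounded_by_coframe (R : realType) (psi b : R) : 1 <= b ->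
  bounded_by (coframe psi b) 2.
Proof.
move=> b1; have b0 : 0 < b by exact: lt_le_trans b1.
rewrite [2](_ : _ = 1 + 1); last by ring.
have bM x : `|x| <= 1 -> `|x / b| <= 1.
  move=> x1; rewrite normrM normfV (gtr0_norm b0) ler_pdivrMr// mul1r.
  exact: le_trans b1.
by apply: bounded_by_rmx; rewrite ?normrN ?bM ?abs_cos_le1 ?abs_sin_le1.
Qed.

(** A rotation only turns the angle phi into phi - psi, and the dilation divides
the upper right entry by b while it multiplies the lower left one by b. *)
Lemma conj_transfer (R : realType) (z : R[i]) (len phi psi b : R) : b != 0 ->
  let c := cos (phi - psi) in let s := sin (phi - psi) in
  coframe psi b *m transfer z len phi *m frame psi b =
  1%:M - z *: rmx (len * (c * s)) (- (len * (c ^+ 2 / b)))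
                  (len * (b * s ^+ 2)) (- (len * (c * s))).
Proof.
move=> b0 c s; rewrite /transfer mulmxBr mulmx1 mulmxBl coframe_frame//.
rewrite subrr cos0 sin0 mul0r mulr0 oppr0 rmx1; congr (_ - _).
have [J00 J01 J10 J11] := JmxE R.
rewrite (_ : cxi phi *m (cxi phi)^T *m Jmx = rmx (cos phi * sin phi) (- cos phi ^+ 2)
  (sin phi ^+ 2) (- (cos phi * sin phi))); last first.
  by apply/mx2P; rewrite !mx2E !cxixiE !cxi0 !cxi1 ?J00 ?J01 ?J10 ?J11 !mxE/=
    ?(rmorphM, rmorphN, rmorphXn)/=; ring.
rewrite scalerA mulrC -scalerA -scalemxAr -scalemxAl; congr (_ *: _).
rewrite (_ : len%:C *: _ = rmx (len * (cos phi * sin phi)) (- (len * cos phi ^+ 2))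
  (len * sin phi ^+ 2) (- (len * (cos phi * sin phi)))); last first.
  by apply/mx2P; rewrite !mxE/= ?(rmorphM, rmorphN, rmorphXn)/=; ring.
rewrite !rmxM; congr rmx; rewrite /c /s ?cosB ?sinB; by field.
Qed.

(** The diagonal correction |c s| is at most half of c^2 / b + b s^2 by the
inequality between the arithmetic and geometric means, and either
off-diagonal entry is at most the whole; this gives the factor 3/2. *)
Lemma bounded_by_conj_transfer (R : realType) (z : R[i]) (len phi psi b : R) :
  0 < b -> 0 <= len ->
  bounded_by (coframe psi b *m transfer z len phi *m frame psi b)
    (1 + 3 / 2 * (cnorm z * (len * (cos (phi - psi) ^+ 2 / b + b * sin (phi - psi) ^+ 2)))).
Proof.
move=> b0 l0; rewrite conj_transfer ?gt_eqF//.
set c := cos _; set s := sin _; set e := c ^+ 2 / b + b * s ^+ 2.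
set M := rmx _ _ _ _.
have cb0 : 0 <= c ^+ 2 / b by rewrite divr_ge0 ?sqr_ge0 ?ltW.
have bs0 : 0 <= b * s ^+ 2 by rewrite mulr_ge0 ?sqr_ge0 ?ltW.
have le0 : 0 <= cnorm z * len by rewrite mulr_ge0 ?cnorm_ge0.
have cs : `|c * s| <= e / 2.
  have /(@divr_ge0 _ _ b) : 0 <= (`|c| - b * `|s|) ^+ 2 by exact: sqr_ge0.
  move=> /(_ (ltW b0)) amgm; rewrite normrM -subr_ge0 /e.
  rewrite -(real_normK (num_real c)) -(real_normK (num_real s)).
  rewrite (_ : _ - _ = (`|c| - b * `|s|) ^+ 2 / b / 2); first exact: divr_ge0.
  by field; rewrite gt_eqF.
rewrite (_ : 1 + _ = (1 + cnorm z * (len * (e / 2))) + cnorm z * (len * e)); last by field.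
have [M00 M01 M10 M11] := rmxE (len * (c * s)) (- (len * (c ^+ 2 / b)))
                  (len * (b * s ^+ 2)) (- (len * (c * s))).
have Mz w k : 0 <= k -> `|w| <= k -> cnorm (z * w%:C) <= cnorm z * k.
  by move=> k0 wk; rewrite cnormM cnorm_real ler_wpM2l ?cnorm_ge0.
have diag w : `|w| <= len * (e / 2) -> cnorm (1 - z * w%:C) <= 1 + cnorm z * (len * (e / 2)).
  move=> wk; apply: le_trans (ler_cnormD _ _) _.
  rewrite cnormN /cnorm ComplexField.Normc.normc1 lerD2l Mz//.
  exact: le_trans wk.
have e0 : 0 <= len * e by rewrite mulr_ge0// addr_ge0.
have lcs : `|len * (c * s)| <= len * (e / 2) by rewrite normrM (ger0_norm l0) ler_wpM2l.
apply: bounded_by_entries; rewrite mxE [X in X + _]mxE ?[X in _ + X]mxE [X in - X]mxE.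
- by rewrite M00 diag.
- by rewrite M11 diag// normrN.
- rewrite M01 sub0r cnormN Mz// normrN ger0_norm; last exact: mulr_ge0.
  by rewrite ler_wpM2l// lerDl.
- rewrite M10 sub0r cnormN Mz// ger0_norm; last exact: mulr_ge0.
  by rewrite ler_wpM2l// lerDr.
Qed.

(** In the frame of its own angle a transfer matrix is unipotent upper
triangular, so no lower left entry is amplified by b. *)
Lemma bounded_by_own_transfer (R : realType) (z : R[i]) (len phi b : R) :
  0 < b -> 0 <= len ->
  bounded_by (coframe phi b *m transfer z len phi *m frame phi b)
    (1 + cnorm z * len / b).
Proof.
move=> b0 l0; rewrite conj_transfer ?gt_eqF// subrr cos0 sin0.
rewrite (_ : rmx _ _ _ _ = rmx 0 (- (len / b)) 0 0); last by congr rmx; field; rewrite ?gt_eqF.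
have [M00 M01 M10 M11] := rmxE 0 (- (len / b)) 0 (0 : R).
apply: bounded_by_entries; rewrite mxE [X in X + _]mxE ?[X in _ + X]mxE [X in - X]mxE.
- by rewrite M00 mulr0 subr0 /cnorm ComplexField.Normc.normc1.
- by rewrite M11 mulr0 subr0 /cnorm ComplexField.Normc.normc1.
- by rewrite M01 sub0r cnormN cnormM cnorm_real normrN ger0_norm ?mulrA// divr_ge0// ltW.
- by rewrite M10 mulr0 subr0 cnorm0 divr_ge0 ?mulr_ge0 ?cnorm_ge0// ltW.
Qed.

Lemma bounded_by_change_frame (R : realType) (phi phi' b b' : R) :
  1 <= b -> 0 < b' ->
  bounded_by (coframe phi b *m frame phi' b')
    ((1 + b * `|sin (phi' - phi)|) * Num.max 1 (b' / b)).
Proof.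
move=> b1 b'0; have b0 : 0 < b by exact: lt_le_trans b1.
have -> : frame phi' b' = frame phi' b *m rmx (b' / b) 0 0 1.
  by rewrite rmxM; congr rmx; field; rewrite ?gt_eqF.
rewrite mulmxA; apply: bounded_by_mul.
- by rewrite addr_ge0// mulr_ge0// ltW.
- rewrite coframe_frame ?gt_eqF//; apply: bounded_by_rmx; rewrite ?abs_cos_le1//.
    rewrite normrN normrM normfV (gtr0_norm b0) ler_pdivrMr//.
    rewrite mulrAC ler_peMl// -[1]mulr1 ler_pM//.
  by rewrite normrM (gtr0_norm b0).
rewrite -[Num.max _ _]addr0; apply: bounded_by_rmx; rewrite ?normr0 ?normr1 ?le_max ?lexx//.
by rewrite gtr0_norm ?divr_gt0// lexx orbT.
Qed.

(** Only conjugated matrices occur once the product of [frame] and [coframe] is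
inserted twice: a change of frame and a transfer matrix in its own frame. *)
Lemma frame_step (R : realType) (V : 'M[R[i]]_2) (z : R[i]) (len phi phi' b b' B : R) :
  1 <= b -> 1 <= b' -> 0 <= len -> 0 <= B -> bounded_by (V *m frame phi b) B ->
  bounded_by (V *m transfer z len phi' *m frame phi' b')
    (B * ((1 + b * `|sin (phi' - phi)|) * Num.max 1 (b' / b)) * (1 + cnorm z * len / b')).
Proof.
move=> b1 b'1 l0 B0 VB; have b0 : 0 < b by exact: lt_le_trans b1.
have b'0 : 0 < b' by exact: lt_le_trans b'1.
have -> : V *m transfer z len phi' *m frame phi' b' =
  (V *m frame phi b *m (coframe phi b *m frame phi' b')) *m
  (coframe phi' b' *m transfer z len phi' *m frame phi' b').
  rewrite !mulmxA -(mulmxA V (frame phi b)) frame_coframe ?gt_eqF// mulmx1.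
  by rewrite -(mulmxA V (frame phi' b')) frame_coframe ?gt_eqF// mulmx1.
have M0 : 0 <= (1 + b * `|sin (phi' - phi)|) * Num.max 1 (b' / b).
  by rewrite mulr_ge0 ?le_max ?ler01// addr_ge0// mulr_ge0// ltW.
apply: bounded_by_mul; [exact: mulr_ge0|apply: bounded_by_mul => //|].
  exact: bounded_by_change_frame.
exact: bounded_by_own_transfer.
Qed.

Lemma fixed_frame_step (R : realType) (V : 'M[R[i]]_2) (z : R[i]) (len phi psi b B : R) :
  0 < b -> 0 <= len -> 0 <= B -> bounded_by (V *m frame psi b) B ->
  bounded_by (V *m transfer z len phi *m frame psi b)
    (B * expR (3 / 2 * (cnorm z * (len * (cos (phi - psi) ^+ 2 / b + b * sin (phi - psi) ^+ 2))))).
Proof.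
move=> b0 l0 B0 VB.
have -> : V *m transfer z len phi *m frame psi b =
  (V *m frame psi b) *m (coframe psi b *m transfer z len phi *m frame psi b).
  by rewrite !mulmxA -(mulmxA V (frame psi b)) frame_coframe ?gt_eqF// mulmx1.
apply: bounded_by_mul => //.
by apply: bounded_byW (bounded_by_conj_transfer _ _ _ b0 l0); exact: expR_ge1Dx.
Qed.

(** * Products of transfer matrices *)

(** The scale of the frame at index j, for a = d_l and p = d_phi: it balances
r l_j / b against b |sin(phi_(j+1) - phi_j)|. *)
Definition frame_scale (R : realType) (r : R) (a p : nat -> R) (j : nat) : R :=
  Num.sqrt (r * a j / p j).
(** The common value of the two balanced quantities, see [frame_scale_load]. *)
Definition step_load (R : realType) (r : R) (a p : nat -> R) (j : nat) : R :=
  Num.sqrt (r * a j * p j).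

Lemma frame_scale_load (R : realType) (r : R) (a p : nat -> R) (j : nat) :
  0 <= r -> 0 < a j -> 0 < p j ->
  frame_scale r a p j * p j = step_load r a p j /\
  frame_scale r a p j * step_load r a p j = r * a j.
Proof.
move=> r0 a0 p0; have ra0 : 0 <= r * a j by rewrite mulr_ge0// ltW.
have q0 : 0 <= r * a j / p j by rewrite divr_ge0// ltW.
split.
  rewrite /frame_scale -{2}[p j]gtr0_norm// -sqrtr_sqr -sqrtrM//.
  by congr Num.sqrt; field; rewrite gt_eqF.
rewrite /frame_scale /step_load -sqrtrM// -[RHS]ger0_norm// -sqrtr_sqr.
by congr Num.sqrt; field; rewrite gt_eqF.
Qed.

Lemma sqrt_expR_ln (R : realType) (x : R) : 0 < x ->
  Num.sqrt x = expR (2^-1 * ln x).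
Proof.
move=> x0; rewrite -[RHS]gtr0_norm ?expR_gt0// -sqrtr_sqr -expRM_natl.
by rewrite (_ : 2%:R * _ = ln x) ?lnK ?posrE//; field.
Qed.

Lemma max1_sqrt_le_expR (R : realType) (x : R) : 0 < x ->
  Num.max 1 (Num.sqrt x) <= expR (2^-1 * `|ln x|).
Proof.
move=> x0; rewrite ge_max sqrt_expR_ln// -[X in X <= _]expR0 !ler_expR.
by rewrite mulr_ge0//= ler_wpM2l// ler_norm.
Qed.

Lemma frame_scale_ratio (R : realType) (r : R) (a p : nat -> R) (i j : nat) :
  0 < r -> 0 < a i -> 0 < p i -> 0 < a j -> 0 < p j ->
  frame_scale r a p j / frame_scale r a p i = Num.sqrt (p i / a i / (p j / a j)).
Proof.
move=> r0 ai pi_ aj pj; rewrite /frame_scale -sqrtrV ?divr_ge0 ?mulr_ge0 ?ltW//.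
rewrite -sqrtrM ?divr_ge0 ?mulr_ge0 ?ltW//; congr Num.sqrt; field.
by rewrite !gt_eqF.
Qed.

(** Each index j contributes the load 1 + q_j twice, once from the transfer
matrix and once from the change of frame that follows it; the last index has
no change of frame, hence the separate term. *)
Lemma head_bound (R : realType) (V : nat -> 'M[R[i]]_2) (z : R[i])
    (l phi a p : nat -> R) (n : nat) :
  let r := cnorm z in let q := step_load r a p in
  0 < r -> V 0 = 1%:M ->
  (forall j, V j.+1 = V j *m transfer z (l j.+1) (phi j.+1)) ->
  (forall j, (0 < j)%N -> [/\ 0 < a j, 0 < p j, 0 < l j & l j <= a j]) ->
  (forall j, (0 < j)%N -> `|sin (phi j.+1 - phi j)| <= p j) ->
  (forall j, (0 < j <= n.+1)%N -> p j <= r * a j) ->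
  bounded_by (V n.+1 *m frame (phi n.+1) (frame_scale r a p n.+1))
    (2 * frame_scale r a p 1 *
     expR (\sum_(1 <= j < n.+1)
             (2 * ln (1 + q j) + 2^-1 * `|ln (p j / a j / (p j.+1 / a j.+1))|)
           + ln (1 + q n.+1))).
Proof.
move=> r q r0 V0 VS pos sinp; set b := frame_scale r a p.
have q0 j : 0 <= q j by exact: sqrtr_ge0.
have b1 j : (0 < j)%N -> p j <= r * a j -> 1 <= b j.
  move=> j0 pra; have [_ pj _ _] := pos j j0.
  by rewrite -[1]sqrtr1 /b /frame_scale ler_wsqrtr// ler_pdivlMr// mul1r.
have len_le j : (0 < j)%N -> p j <= r * a j -> 1 + r * l j / b j <= 1 + q j.
  move=> j0 pra; have [aj pj lj la] := pos j j0.
  rewrite lerD2l ler_pdivrMr ?(lt_le_trans ltr01 (b1 _ j0 pra))//.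
  by rewrite [leRHS]mulrC /b /q (frame_scale_load (ltW r0) aj pj).2 ler_pM2l.
elim: n => [|n IH] good.
  rewrite big_geq// add0r lnK ?posrE ?ltr_pwDl// VS V0 mul1mx.
  have good1 := good 1%N isT; have bb := b1 1%N isT good1.
  have b0 : 0 < b 1%N by exact: lt_le_trans bb.
  rewrite -[X in X *m _]mul1mx -(frame_coframe (phi 1%N) (lt0r_neq0 b0)) -!mulmxA.
  apply: bounded_by_mul; [by rewrite mulr_ge0// ltW|exact: bounded_by_frame|].
  apply: (bounded_byW (len_le 1%N isT good1)); rewrite mulmxA.
  have [_ _ l1 _] := pos 1%N isT.
  exact: bounded_by_own_transfer (ltW l1).
have gn j : (0 < j <= n.+1)%N -> p j <= r * a j.
  by move=> /andP[j0 jn]; apply: good; rewrite j0 ltnW.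
have {}IH := IH gn.
have g1 := gn n.+1 (ltac:(by rewrite ltnSn)).
have g2 := good n.+2 (ltac:(by rewrite ltnSn)).
have [a1 p1 l1 la1] := pos n.+1 isT; have [a2 p2 l2 la2] := pos n.+2 isT.
rewrite VS; set B := (X in bounded_by _ X) in IH.
have B0 : 0 <= B by rewrite /B mulr_ge0 ?expR_ge0// mulr_ge0// sqrtr_ge0.
have := frame_step z (phi n.+2) (b1 n.+1 isT g1) (b1 n.+2 isT g2) (ltW l2) B0 IH.
apply: bounded_byW.
rewrite big_nat_recr// /B.
set S := \sum_(_ <= _ < _) _.
set c := 2^-1 * _.
have -> : S + (2 * ln (1 + q n.+1) + c) + ln (1 + q n.+2) =
  (S + ln (1 + q n.+1)) + (ln (1 + q n.+1) + c) + ln (1 + q n.+2) by ring.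
rewrite [in leRHS]expRD [in leRHS]expRD !mulrA.
rewrite [expR (ln (1 + q n.+2))]lnK ?posrE ?ltr_pwDl//.
apply: ler_pM; rewrite ?mulr_ge0 ?addr_ge0 ?le_max ?ler01
  ?divr_ge0 ?mulr_ge0 ?sqrtr_ge0 ?expR_ge0 ?(ltW r0) ?(ltW l2)//; last exact: len_le.
rewrite -!mulrA ler_wpM2l// ler_wpM2l ?sqrtr_ge0// ler_wpM2l ?expR_ge0//.
rewrite expRD lnK ?posrE ?ltr_pwDl//.
apply: ler_pM; rewrite ?addr_ge0 ?mulr_ge0 ?sqrtr_ge0 ?le_max ?ler01//.
  by rewrite lerD2l /q -(frame_scale_load (ltW r0) a1 p1).1 ler_wpM2l ?sqrtr_ge0// sinp.
rewrite frame_scale_ratio// max1_sqrt_le_expR//.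
by rewrite !divr_gt0.
Qed.

(** This is [fixed_frame_step] in the standard frame, where cos^2 + sin^2 = 1. *)
Lemma crude_step (R : realType) (V : 'M[R[i]]_2) (z : R[i]) (len phi B : R) :
  0 <= len -> 0 <= B -> bounded_by V B ->
  bounded_by (V *m transfer z len phi) (B * expR (3 / 2 * (cnorm z * len))).
Proof.
move=> l0 B0 VB.
have f1 : frame 0 1 = 1%:M :> 'M[R[i]]_2.
  by rewrite /frame cos0 sin0 oppr0 !mulr0 mulr1 rmx1.
have := @fixed_frame_step R V z len phi 0 1 B ltr01 l0 B0.
rewrite f1 !mulmx1 subr0 divr1 mul1r cos2Dsin2 mulr1; exact.
Qed.

Lemma middle_bound (R : realType) (V : nat -> 'M[R[i]]_2) (z : R[i])
    (l phi : nat -> R) (m n : nat) (B : R) :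
  (forall j, V j.+1 = V j *m transfer z (l j.+1) (phi j.+1)) ->
  (forall j, (0 < j)%N -> 0 < l j) -> 0 <= B -> (m <= n)%N ->
  bounded_by (V m) B ->
  bounded_by (V n) (B * expR (3 / 2 * \sum_(m.+1 <= j < n.+1) cnorm z * l j)).
Proof.
move=> VS l0 B0 mn VB; rewrite -(subnKC mn).
elim: (n - m)%N => [|k IH]; first by rewrite addn0 big_geq// mulr0 expR0 mulr1.
rewrite addnS VS big_nat_recr ?ltnS ?leq_addr//= mulrDr expRD mulrA.
by apply: crude_step => //; [exact/ltW/l0|rewrite mulr_ge0 ?expR_ge0].
Qed.

(** In one fixed frame of scale b the block costs
exp((3/2) |z| (C / b + b c)), and b = (C / c)^(1/2) makes both terms equal to
(C c)^(1/2).  The factor 4 b is the price of entering and leaving the frame. *)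
Lemma tail_bound (R : realType) (V : nat -> 'M[R[i]]_2) (z : R[i])
    (l phi : nat -> R) (m n : nat) (B psi C c : R) :
  (forall j, V j.+1 = V j *m transfer z (l j.+1) (phi j.+1)) ->
  (forall j, (0 < j)%N -> 0 < l j) -> 0 <= B -> (m <= n)%N ->
  0 < c -> c <= C ->
  \sum_(m.+1 <= j < n.+1) l j <= C ->
  \sum_(m.+1 <= j < n.+1) l j * sin (phi j - psi) ^+ 2 <= c ->
  bounded_by (V m) B ->
  bounded_by (V n) (B * (4 * Num.sqrt (C / c) * expR (3 * (cnorm z * Num.sqrt (C * c))))).
Proof.
move=> VS l0 B0 mn c0 cC lC lc VB; have C0 : 0 < C by exact: lt_le_trans cC.
pose b := Num.sqrt (C / c).
have b1 : 1 <= b by rewrite -[1]sqrtr1 ler_wsqrtr// ler_pdivlMr// mul1r.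
have b0 : 0 < b by exact: lt_le_trans b1.
pose e j := cos (phi j - psi) ^+ 2 / b + b * sin (phi j - psi) ^+ 2.
have Bn : bounded_by (V n *m frame psi b)
    (B * (2 * b) * expR (3 / 2 * (cnorm z * \sum_(m.+1 <= j < n.+1) l j * e j))).
  clear lC lc; rewrite -(subnKC mn).
  elim: (n - m)%N => [|k IH].
    rewrite addn0 big_geq// !mulr0 expR0 mulr1; apply: bounded_by_mul => //.
    exact: bounded_by_frame.
  rewrite addnS VS big_nat_recr ?ltnS ?leq_addr//= (mulrDr (cnorm z)) (mulrDr (3 / 2)) expRD mulrA.
  apply: fixed_frame_step => //; first exact/ltW/l0.
  by rewrite !mulr_ge0 ?expR_ge0// ltW.
rewrite -[V n]mulmx1 -(frame_coframe psi (lt0r_neq0 b0)) mulmxA.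
set E := expR _ in Bn.
have E_le : E <= expR (3 * (cnorm z * Num.sqrt (C * c))).
  rewrite ler_expR; have Cb : C / b = Num.sqrt (C * c).
    rewrite -[C in LHS]gtr0_norm// -sqrtr_sqr /b -sqrtrV ?divr_ge0 ?ltW//.
    by rewrite -sqrtrM ?sqr_ge0//; congr Num.sqrt; field; rewrite !gt_eqF.
  have bc : b * c = Num.sqrt (C * c).
    rewrite -[c in LHS]gtr0_norm// -sqrtr_sqr /b -sqrtrM ?divr_ge0 ?ltW//.
    by congr Num.sqrt; field; rewrite gt_eqF.
  have le2 : \sum_(m.+1 <= j < n.+1) l j * e j <= 2 * Num.sqrt (C * c).
    rewrite (_ : 2 * _ = C / b + b * c); last by rewrite Cb bc; ring.
    apply: (@le_trans _ _ ((\sum_(m.+1 <= j < n.+1) l j) / b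
       + b * \sum_(m.+1 <= j < n.+1) l j * sin (phi j - psi) ^+ 2)); last first.
      by rewrite lerD// ?ler_wpM2l ?ler_wpM2r ?invr_ge0// ltW.
    rewrite mulr_suml mulr_sumr -big_split/= !big_nat; apply: ler_sum => j /andP[mj _].
    have lj : 0 < l j by apply: l0; exact: leq_trans mj.
    rewrite /e mulrDr lerD//; last by rewrite mulrCA.
    rewrite ler_wpM2l ?(ltW lj)// ler_piMl ?invr_ge0 ?(ltW b0)//.
  rewrite (_ : 3 * (cnorm z * Num.sqrt (C * c)) = 3 / 2 * (cnorm z * (2 * Num.sqrt (C * c)))); last by field.
  by rewrite ler_wpM2l// ler_wpM2l ?cnorm_ge0.
apply: bounded_byW (bounded_by_mul _ Bn (bounded_by_coframe psi b1)).
  rewrite (_ : B * (2 * b) * E * 2 = B * (4 * b * E)); last by ring.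
  by rewrite ler_wpM2l// ler_wpM2l// mulr_ge0// ltW.
by rewrite !mulr_ge0 ?expR_ge0// ltW.
Qed.

(** * The growth functions *)

(** The points of which [h_growth] is the supremum, with the division cleared. *)
Definition h_set (R : realType) (dl dphi : R -> R) (r : R) : set R :=
  [set t | 1 <= t /\ forall s, 1 <= s <= t -> dphi s <= r * dl s].

Lemma lt_k_growth (R : realType) (dl dphi : R -> R) (r s : R) :
  0 < r -> (forall t, 1 <= t -> 0 < dl t) -> (forall t, 1 <= t -> 0 < dphi t) ->
  1 <= s -> (s%:E < k_growth dl dphi r)%E -> 2 <= r * dl s * dphi s.
Proof.
move=> r0 dl0 dphi0 s1 /ereal_sup_gt[_ [t [t1 /ereal_supP tk] <-]].
rewrite lte_fin => st.
have := tk (2 / (r * dl s * dphi s))%:E; rewrite lee_fin ler_pdivrMr ?mul1r; last first.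
  by rewrite !mulr_gt0 ?dl0 ?dphi0.
by apply; exists s => //=; rewrite in_itv/= s1 ltW.
Qed.

Lemma h_set_ub (R : realType) (dl dphi : R -> R) (r t : R) :
  0 < r -> (forall t, 1 <= t -> 0 < dl t) ->
  h_set dl dphi r t -> (t%:E <= h_growth dl dphi r)%E.
Proof.
move=> r0 dl0 [t1 ht]; apply: ereal_sup_ubound; exists t => //; split => //.
apply/ereal_supP => _ [s /= + <-]; rewrite in_itv/= => s1t.
rewrite lee_fin ler_pdivrMr ?mul1r ?ht// mulr_gt0// dl0//.
by case/andP: s1t.
Qed.

Lemma h_growth_le (R : realType) (dl dphi : R -> R) (r t : R) :
  0 < r -> (forall t, 1 <= t -> 0 < dl t) -> 1 <= t ->
  ~ h_set dl dphi r t -> (h_growth dl dphi r <= t%:E)%E.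
Proof.
move=> r0 dl0 t1 nht; apply/ereal_supP => _ [u [u1 /ereal_supP hu] <-].
rewrite lee_fin leNgt; apply/negP => tu; apply: nht; split => // s /andP[s1 st].
have := hu (dphi s / (r * dl s))%:E; rewrite lee_fin ler_pdivrMr ?mul1r; last first.
  by rewrite mulr_gt0// dl0.
by apply; exists s => //=; rewrite in_itv/= s1 (le_trans st)// ltW.
Qed.

(** From R d_l d_phi >= 2 and d_phi <= 1 one gets
d_phi <= 1 <= R d_l d_phi <= R d_l. *)
Lemma k_le_h_growth (R : realType) (dl dphi : R -> R) (r : R) :
  0 < r -> (forall t, 1 <= t -> 0 < dl t) -> (forall t, 1 <= t -> 0 < dphi t) ->
  (forall t, 1 <= t -> dphi t <= 1) ->
  (k_growth dl dphi r <= h_growth dl dphi r)%E.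
Proof.
move=> r0 dl0 dphi0 dphi1; apply: le_ereal_sup => _ [t [t1 /ereal_supP tk] <-].
exists t => //; split => //; apply/ereal_supP => _ [s /= + <-]; rewrite in_itv/= => s1t.
have s1 : 1 <= s by case/andP: s1t.
have rs : 0 < r * dl s by rewrite mulr_gt0 ?dl0.
have rsp : 0 < r * dl s * dphi s by rewrite mulr_gt0 ?dphi0.
have le2 : 2 <= r * dl s * dphi s.
  have := tk (2 / (r * dl s * dphi s))%:E; rewrite lee_fin ler_pdivrMr// mul1r; apply.
  by exists s => //=; rewrite in_itv.
rewrite lee_fin ler_pdivrMr// mul1r.
by have := dphi1 s s1; have := dphi0 s s1; nra.
Qed.

Lemma two_ln1D_sqrt_le (R : realType) (x : R) : 0 <= x ->
  2 * ln (1 + Num.sqrt x) <= 3 * Num.sqrt x.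
Proof.
move=> x0; have := @le_ln1Dx R (Num.sqrt x).
have := sqrtr_ge0 x; move: (Num.sqrt x) => y y0 /(_ _).
rewrite (lt_le_trans _ y0) ?ltrN10// => /(_ isT); lra.
Qed.

(** With q = x^(1/2) this is 1 + q <= q^3, which follows from
1 + q <= 2 q <= q^2 q. *)
Lemma two_ln1D_sqrt_le_ln (R : realType) (x : R) : 2 <= x ->
  2 * ln (1 + Num.sqrt x) <= 3 * ln x.
Proof.
move=> x2; have x0 : 0 < x by exact: lt_le_trans x2.
set q := Num.sqrt x; have q0 : 0 < q by rewrite sqrtr_gt0.
have qq : q ^+ 2 = x by rewrite sqr_sqrtr// ltW.
have q1 : 1 <= q by nra.
have <- : 2 * ln (q ^+ 3) = 3 * ln x.
  by rewrite -qq !lnXn// -[in LHS]mulr_natl -[in RHS]mulr_natl; ring.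
rewrite ler_wpM2l// ler_ln ?posrE ?exprn_gt0 ?addr_gt0//.
by rewrite exprS qq; nra.
Qed.

Lemma g_growth_ge0 (R : realType) (dl dphi : R -> R) (r s : R) :
  0 < r -> (forall t, 1 <= t -> 0 < dl t) -> (forall t, 1 <= t -> 0 < dphi t) ->
  1 <= s -> 0 <= g_growth dl dphi s r.
Proof.
move=> r0 dl0 dphi0 s1; rewrite /g_growth; case: ifPn => [sk|_].
  by rewrite ln_ge0// (le_trans _ (lt_k_growth r0 dl0 dphi0 s1 sk))// ler1n.
by case: ifP => _; rewrite mulr_ge0 ?sqrtr_ge0 ?ltW ?dl0.
Qed.

(** Below k one uses [two_ln1D_sqrt_le_ln], between k and h the inequality
log(1 + q) <= q; in both cases the load is monotone in the index. *)
Lemma load_le_g_growth (R : realType) (dl dphi : R -> R) (r s : R) (j : nat) :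
  0 < r -> (forall t, 1 <= t -> 0 < dl t) -> (forall t, 1 <= t -> 0 < dphi t) ->
  (forall s t, 1 <= s -> s <= t -> dl t <= dl s) ->
  (forall s t, 1 <= s -> s <= t -> dphi t <= dphi s) ->
  1 <= s -> s <= j%:R -> (s%:E < h_growth dl dphi r)%E ->
  2 * ln (1 + step_load r (fun j => dl j%:R) (fun j => dphi j%:R) j)
    <= 3 * g_growth dl dphi s r.
Proof.
move=> r0 dl0 dphi0 dln dphin s1 sj sh.
have j1 : 1 <= j%:R :> R by exact: le_trans sj.
have x0 : 0 <= r * dl s * dphi s by rewrite !mulr_ge0 ?ltW ?dl0 ?dphi0.
apply: (@le_trans _ _ (2 * ln (1 + Num.sqrt (r * dl s * dphi s)))).
  rewrite ler_wpM2l// ler_ln ?posrE ?ltr_pwDl ?sqrtr_ge0// lerD2l ler_wsqrtr//.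
  rewrite -!mulrA ler_wpM2l ?(ltW r0)//.
  by rewrite ler_pM ?dln ?dphin// ltW ?dl0 ?dphi0.
rewrite /g_growth; case: ifPn => [sk|_].
  by apply: two_ln1D_sqrt_le_ln; exact: lt_k_growth sk.
rewrite sh; apply: (le_trans (two_ln1D_sqrt_le x0)).
by rewrite -(mulrA r) sqrtrM// ltW.
Qed.

(** Beyond h, hence also beyond k, the value of g is r d_l(s). *)
Lemma length_le_g_growth (R : realType) (dl dphi : R -> R) (r s : R) (j : nat) :
  0 < r -> (forall t, 1 <= t -> 0 < dl t) -> (forall t, 1 <= t -> 0 < dphi t) ->
  (forall t, 1 <= t -> dphi t <= 1) ->
  (forall s t, 1 <= s -> s <= t -> dl t <= dl s) ->
  1 <= s -> s <= j%:R -> (h_growth dl dphi r <= s%:E)%E ->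
  r * dl j%:R <= g_growth dl dphi s r.
Proof.
move=> r0 dl0 dphi0 dphi1 dln s1 sj hs; rewrite /g_growth.
rewrite ltNge (le_trans (k_le_h_growth r0 dl0 dphi0 dphi1) hs)/= ltNge hs/=.
by rewrite ler_wpM2l ?dln// ltW.
Qed.

Lemma measurable_g_growth (R : realType) (dl dphi : R -> R) (r : R) :
  measurable_fun [set t : R | 1 <= t] dl ->
  measurable_fun [set t : R | 1 <= t] dphi ->
  measurable_fun [set t : R | 1 <= t] (fun s => g_growth dl dphi s r).
Proof.
move=> mdl mdphi; have DE : [set t : R | 1 <= t] = `[1, +oo[%classic.
  by apply/seteqP; split=> x /=; rewrite in_itv/= andbT.
rewrite DE in mdl mdphi *; have mD : measurable (`[1, +oo[%classic : set R) by [].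
have msqrt : measurable_fun [set: R] (@Num.sqrt R).
  by apply: continuous_measurable_fun => x; exact: sqrt_continuous.
have mlt (y : \bar R) : measurable_fun (`[1, +oo[%classic : set R) (fun s : R => (s%:E < y)%E).
  by apply: measurable_fun_lte => //; exact/measurable_EFinP.
have mr : measurable_fun (`[1, +oo[%classic : set R) (fun s => r * dl s).
  exact: measurable_funM.
have mln : measurable_fun (`[1, +oo[%classic : set R) (fun s => ln (r * dl s * dphi s)).
  apply: (@measurableT_comp _ _ _ _ _ _ (@ln R) _ (fun s => r * dl s * dphi s)).
    exact: measurable_ln.
  exact: measurable_funM.
have msq : measurable_fun (`[1, +oo[%classic : set R)
    (fun s => Num.sqrt r * Num.sqrt (dl s * dphi s)).
  apply: measurable_funM => //.
  apply: (@measurableT_comp _ _ _ _ _ _ (@Num.sqrt R) _ (fun s => dl s * dphi s)) => //.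
  exact: measurable_funM.
apply: measurable_fun_if => //; first exact: measurable_funS mln.
apply: (@measurable_funS _ _ _ _ (`[1, +oo[%classic : set R)) => //.
by apply: measurable_fun_if => //; [exact: measurable_funS msq|exact: measurable_funS mr].
Qed.

(** Comparison on the unit intervals [j, j + 1[, which for t >= n + 1 lie in
[1, t]. *)
Lemma sum_le_integral (R : realType) (f : R -> R) (w : nat -> R) (t : R) (n : nat) :
  measurable_fun [set s : R | 1 <= s] f -> (forall s, 1 <= s -> 0 <= f s) ->
  (forall j, 0 <= w j) ->
  (forall j s, (0 < j < n.+1)%N -> j%:R <= s < j.+1%:R -> w j <= f s) ->
  n.+1%:R <= t ->
  ((\sum_(1 <= j < n.+1) w j)%:E <= \int[@lebesgue_measure R]_(s in `[1%R, t]) (f s)%:E)%E.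
Proof.
move=> mf f0 w0 wf nt.
have mfS (A : set R) : measurable A -> A `<=` [set s : R | 1 <= s] ->
    measurable_fun A (EFin \o f).
  move=> mA AS; apply/measurable_EFinP; apply: measurable_funS mf => //.
  by rewrite (_ : [set _ | _] = `[1, +oo[%classic)//; apply/seteqP; split=> x /=; rewrite in_itv/= andbT.
apply: (@le_trans _ _ (\int[@lebesgue_measure R]_(s in `[1%R, n.+1%:R[) (f s)%:E)%E); last first.
  apply: ge0_subset_integral => //.
  - by apply: mfS => // x /=; rewrite in_itv/= => /andP[].
  - by move=> x /=; rewrite in_itv/= lee_fin => /andP[x1 _]; exact: f0.
  - by move=> x /=; rewrite !in_itv/= => /andP[-> /ltW /le_trans->].
elim: n wf nt => [|n IH] wf nt; first rewrite big_geq// integral_ge0// => x /=.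
  by rewrite in_itv/= lee_fin => /andP[x1 _]; exact: f0.
have nn1 : n.+1%:R <= n.+2%:R :> R by rewrite ler_nat.
have n1 : 1 <= n.+1%:R :> R by rewrite ler1n.
rewrite (_ : `[1%R, n.+2%:R[%classic = `[1%R, n.+1%:R[%classic `|` `[n.+1%:R, n.+2%:R[%classic); last first.
  apply/seteqP; split=> x /=; rewrite !in_itv/=.
    by move=> /andP[-> ->]/=; rewrite andbT; have [|] := ltP x n.+1%:R; [left|right].
  by move=> [/andP[-> /lt_le_trans->]//|/andP[/(le_trans n1)-> ->]].
rewrite ge0_integral_setU//=; first last.
- apply/disj_setPS => x /= []; rewrite !in_itv/= => /andP[_ x1] /andP[x2 _].
  by move: (lt_le_trans x1 x2); rewrite ltxx.
- move=> x []; rewrite /= in_itv/= lee_fin => /andP[x1 _]; apply: f0 => //.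
  exact: le_trans x1.
- apply: mfS; first exact: measurableU.
  by move=> x []; rewrite /= in_itv/= => /andP[x1 _] //; exact: le_trans x1.
rewrite big_nat_recr// EFinD; apply: leeD.
  apply: IH; last exact: le_trans nt.
  by move=> j s /andP[j0 jn]; apply: wf; rewrite j0 ltnW.
apply: (@le_trans _ _ (\int[@lebesgue_measure R]_(s in `[n.+1%:R, n.+2%:R[) cst (w n.+1)%:E s)%E).
  have len1 : lebesgue_measure (`[n.+1%:R, n.+2%:R[%classic : set R) = 1%:E.
    rewrite lebesgue_measure_itv/= lte_fin ltr_nat ltnSn -EFinD.
    by congr EFin; rewrite [n.+2%:R]mulrS addrK.
  by rewrite integral_cst// [X in (_ * X)%E](_ : _ = 1%:E) ?mule1//; exact: len1.
apply: ge0_le_integral => //.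
- by move=> x _; rewrite lee_fin.
- apply: mfS => // x /=; rewrite in_itv/= => /andP[x1 _]; exact: le_trans x1.
- by move=> x /=; rewrite in_itv/= lee_fin => xn; apply: wf => //; rewrite /= ltnSn.
Qed.

(** * Comparing the loads with the growth integral *)

Lemma nceil_itv (R : realType) (t : R) : 1 <= t ->
  [/\ (0 < nceil t)%N, t <= (nceil t)%:R & (nceil t).-1%:R < t].
Proof.
move=> t1; have := ceil_itv t; rewrite /nceil.
have c1 : (1 <= Num.ceil t)%R by rewrite -gtz0_ge1 ceil_gt0 (lt_le_trans ltr01).
case: (Num.ceil t) c1 => [[|n]|]// _ /= /andP[nt tn]; split => //.
by move: nt; rewrite intS addrC addKr.
Qed.

Lemma le_m_index (R : realType) (dl dphi : R -> R) (r t : R) (n : nat) :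
  (n <= nceil t)%N -> (n%:R%:E <= h_growth dl dphi r)%E ->
  (n <= m_index dl dphi t r)%N.
Proof.
rewrite /m_index => nt; case: (h_growth _ _ _) => [x| |]//.
rewrite lee_fin leq_min nt /= => nx; rewrite truncn_ge_nat//.
exact: le_trans nx.
Qed.

Lemma lnplus_ge (R : realType) (x : R) : ln x <= lnplus x.
Proof. by rewrite /lnplus le_max lexx. Qed.

Lemma lnplus_ge0 (R : realType) (x : R) : 0 <= lnplus x.
Proof. by rewrite /lnplus le_max lexx orbT. Qed.

Lemma sum_indicator_le1 (R : realType) (m n : nat) :
  \sum_(1 <= j < n.+1) (j == m)%:R <= 1 :> R.
Proof.
have [mn|nm] := leqP m n.
  suff -> : \sum_(1 <= j < n.+1) (j == m)%:R = (0 < m)%N%:R :> R by case: (0 < m)%N; rewrite ?lexx ?ler01.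
  elim: n mn => [|n IH]; first by rewrite leqn0 big_geq// => /eqP->.
  rewrite big_nat_recr//= leq_eqVlt => /orP[/eqP->|mn].
    rewrite eqxx big_nat big1 ?add0r// => i /andP[_ lin].
    by rewrite lt_eqF.
  by rewrite IH// gtn_eqF// addr0.
rewrite big_nat big1 ?ler01// => i /andP[_ lin]; rewrite lt_eqF//.
exact: leq_trans lin nm.
Qed.

(** If r d_l(u) > 1 then r d_l > 1 >= d_phi on all of [1, u] by monotonicity. *)
Lemma not_h_set_length_le1 (R : realType) (dl dphi : R -> R) (r u : R) :
  0 < r -> (forall t, 1 <= t -> dphi t <= 1) ->
  (forall s t, 1 <= s -> s <= t -> dl t <= dl s) -> 1 <= u ->
  ~ h_set dl dphi r u -> r * dl u <= 1.
Proof.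
move=> r0 dphi1 dln u1 nh; rewrite leNgt; apply/negP => lt1; apply: nh.
split => // s /andP[s1 su]; apply: (le_trans (dphi1 s s1)).
by apply: (le_trans (ltW lt1)); rewrite ler_pM2l// dln.
Qed.

(** Uses y <= 1 <= 1 / y. *)
Lemma ln_first_load_le (R : realType) (r x y : R) :
  0 < r -> 0 < x -> 0 < y -> y <= 1 ->
  ln (r * x * y) <= lnplus r + lnplus (x / y).
Proof.
move=> r0 x0 y0 y1; rewrite -mulrA lnM ?posrE ?mulr_gt0//.
apply: lerD; first exact: lnplus_ge.
apply: le_trans (lnplus_ge _); rewrite ler_ln ?posrE ?mulr_gt0 ?invr_gt0//.
by rewrite ler_pM2l// (le_trans y1)// invr_ge1 ?unitfE ?gt_eqF.
Qed.

(** The term of index j + 1 is compared with g on [j, j + 1[, which needs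
j + 1 <= N - 1 for N = ceil(t) and j <> m.  The three remaining terms are
bounded directly: a load never exceeds the first one, and beyond m the
quantity r d_l(j) is at most 1. *)
Lemma total_load_le (R : realType) (dl dphi : R -> R) (r t G : R) (m : nat) :
  (forall t, 1 <= t -> 0 < dl t) -> (forall t, 1 <= t -> 0 < dphi t) ->
  (forall t, 1 <= t -> dphi t <= 1) ->
  measurable_fun [set t : R | 1 <= t] dl ->
  measurable_fun [set t : R | 1 <= t] dphi ->
  (forall s t, 1 <= s -> s <= t -> dl t <= dl s) ->
  (forall s t, 1 <= s -> s <= t -> dphi t <= dphi s) ->
  0 < r -> 2 <= r * dl 1 * dphi 1 -> 1 <= t ->
  g_integral dl dphi t r = G%:E ->
  (0 < m <= nceil t)%N -> (m%:R%:E <= h_growth dl dphi r)%E ->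
  ((m < nceil t)%N -> ~ h_set dl dphi r m.+1%:R) ->
  \sum_(1 <= j < (nceil t).+1)
    (if (j <= m)%N
     then 2 * ln (1 + step_load r (fun j => dl j%:R) (fun j => dphi j%:R) j)
     else 3 / 2 * (r * dl j%:R))
  <= 6 * (lnplus r + lnplus (dl 1 / dphi 1)) + 3 * G + 3.
Proof.
move=> dl0 dphi0 dphi1 mdl mdphi dln dphin r0 rq t1 GE mt mh nh.
set q := step_load r _ _.
case/andP: mt => m0 mt; have [N0 tN Nt] := nceil_itv t1.
set A := lnplus r + _; have A0 : 0 <= A by rewrite addr_ge0 ?lnplus_ge0.
pose tau (j : nat) := if (j <= m)%N then 2 * ln (1 + q j) else 3 / 2 * (r * dl j%:R).
rewrite -[leLHS]/(\sum_(1 <= j < (nceil t).+1) tau j).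
have q0 j : 0 <= q j by exact: sqrtr_ge0.
have j1 j : (0 < j)%N -> 1 <= j%:R :> R by rewrite ler1n.
have load_le j : (0 < j)%N -> 2 * ln (1 + q j) <= 3 * A.
  move=> j0; apply: (@le_trans _ _ (2 * ln (1 + Num.sqrt (r * dl 1 * dphi 1)))).
    rewrite ler_wpM2l// ler_ln ?posrE ?ltr_pwDl ?sqrtr_ge0// lerD2l ler_wsqrtr//.
    rewrite -!mulrA ler_wpM2l ?(ltW r0)//.
    by rewrite ler_pM ?dln ?dphin ?j1// ltW ?dl0 ?dphi0 ?j1.
  apply: (le_trans (two_ln1D_sqrt_le_ln rq)); rewrite ler_wpM2l//.
  by apply: ln_first_load_le; rewrite ?dl0 ?dphi0 ?dphi1.
have len_le j : (m < j <= nceil t)%N -> r * dl j%:R <= 1.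
  case/andP => mj jN.
  have := not_h_set_length_le1 r0 dphi1 dln (j1 m.+1 isT) (nh (leq_trans mj jN)).
  by apply: le_trans; rewrite ler_pM2l// dln ?ler_nat// ler1n.
have tau_le j : (0 < j <= nceil t)%N -> tau j <= 3 * A + 3 / 2.
  case/andP=> j0 jN; rewrite /tau; case: ifPn => [jm|].
    by apply: (le_trans (load_le j j0)); rewrite lerDl.
  rewrite -ltnNge => mj; have := len_le j; rewrite mj jN => /(_ isT); lra.
have tau1 : tau 1%N <= 3 * A by rewrite /tau m0 load_le.
(* The index j = m is the one whose unit interval may contain h. *)
pose w j := if (j.+1 <= m)%N then 2 / 3 * ln (1 + q j.+1) else
            if j == m then 0 else r * dl j.+1%:R.
have w0 j : 0 <= w j.
  rewrite /w; case: ifP => _; first by rewrite mulr_ge0// ln_ge0// lerDl.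
  by case: ifP => // _; rewrite mulr_ge0 ?ltW ?dl0 ?j1.
have tau_w j : (j.+1 <= nceil t)%N -> tau j.+1 <= 3 * w j + 3 / 2 * (j == m)%:R.
  move=> jN; rewrite /tau /w; case: ifPn => [jm|].
    by rewrite ltn_eqF// mulr0 addr0 mulrA (_ : 3 * (2 / 3) = 2)//; field.
  rewrite -ltnNge ltnS => mj; have := len_le j.+1; rewrite ltnS mj jN => /(_ isT) le1.
  have rd0 : 0 < r * dl j.+1%:R by rewrite mulr_gt0 ?dl0 ?j1.
  by case: eqVneq => _ /=; lra.
case: (nceil t) N0 tN Nt mt nh len_le tau_le tau_w => // N _ tN Nt mt nh len_le tau_le tau_w.
have G0 : 0 <= G.
  rewrite -lee_fin -GE; apply: integral_ge0 => s /=; rewrite in_itv/= => /andP[s1 _].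
  by rewrite lee_fin g_growth_ge0.
rewrite big_ltn// big_add1/=.
case: N tN Nt mt nh len_le tau_le tau_w => [|n] tN Nt mt nh len_le tau_le tau_w.
  rewrite big_geq// addr0; apply: (le_trans tau1); lra.
rewrite big_nat_recr//=.
have wG : \sum_(1 <= j < n.+1) w j <= G.
  rewrite -lee_fin -GE; apply: sum_le_integral => //.
  - exact: measurable_g_growth.
  - by move=> s s1; exact: g_growth_ge0.
  - move=> j s /andP[j0 jn] /andP[js sj]; have s1 : 1 <= s by rewrite (le_trans _ js)// j1.
    rewrite /w; case: ifPn => [jm|].
      rewrite -(ler_pM2l (ltr0Sn R 2)) mulrA (_ : 3 * (2 / 3) = 2); last by field.
      apply: load_le_g_growth => //; first exact: ltW.
      apply: lt_le_trans mh; rewrite lte_fin (lt_le_trans sj)// ler_nat//.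
    rewrite -ltnNge ltnS leq_eqVlt eq_sym; case: eqVneq => [_ _|_ /= mj].
      exact: g_growth_ge0.
    apply: length_le_g_growth => //; first exact: ltW.
    have mn : (m < n.+2)%N by rewrite (leq_trans mj)// (leq_trans (ltnW jn))// leqnSn.
    apply: (le_trans (h_growth_le r0 dl0 _ (nh mn))); first exact: j1.
    by rewrite lee_fin (le_trans _ js)// ler_nat.
  - exact: ltW.
have sum_le : \sum_(1 <= j < n.+1) tau j.+1 <= 3 * G + 3 / 2.
  apply: (@le_trans _ _ (3 * \sum_(1 <= j < n.+1) w j +
                         3 / 2 * \sum_(1 <= j < n.+1) (j == m)%:R)).
    rewrite !mulr_sumr -big_split/= !big_nat; apply: ler_sum => j /andP[_ jn].
    by apply: tau_w; rewrite ltnW.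
  have := sum_indicator_le1 R m n; lra.
have := tau_le n.+2; rewrite ltnSn => /(_ isT); lra.
Qed.

(** * The growth bound *)

(** The numerical factor 2 * 2 * 4 = 16 is at most e^4. *)
Lemma le_expR_assemble (R : realType) (b c A C E1 E2 E3 : R) :
  0 <= b -> 0 <= c -> b <= expR A -> c <= expR C ->
  2 * b * expR E1 * 2 * expR E2 * (4 * c * expR E3)
    <= expR (4 + A + C + E1 + E2 + E3).
Proof.
move=> b0 c0 bA cC.
have e2 : 2 <= expR 1 :> R by rewrite (le_trans _ (expR_ge1Dx 1)).
have e16 : 16 <= expR 4 :> R.
  rewrite (_ : 4 = 4%:R * 1); last by rewrite mulr1.
  rewrite expRM_natl; have := @lerXn2r R 4 2 (expR 1).
  rewrite !nnegrE ler0n expR_ge0 => /(_ isT isT e2); apply: le_trans.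
  by rewrite -natrX.
rewrite (_ : _ * _ = 16 * b * c * (expR E1 * expR E2 * expR E3)); last by ring.
have -> : expR (4 + A + C + E1 + E2 + E3) =
  expR 4 * expR A * expR C * (expR E1 * expR E2 * expR E3) by rewrite !expRD; ring.
rewrite ler_wpM2r ?mulr_ge0 ?expR_ge0//.
by apply: ler_pM => //; [exact: mulr_ge0|exact: ler_pM].
Qed.

(** The logarithm of the bound assembled from the three blocks is at most
7 + 13/2 (log^+ R + log^+ (d_l(1) / d_phi(1))) + 3 G + 3 R (c_l c_phi)^(1/2)
+ 1/2 log^+ (c_l / c_phi) + 1/2 (the sum of logarithms),
each coefficient of which is at most 9, also after adding the two
coefficients 3 for the maximum. *)
Lemma monodromy_bound (R : realType) (l phi : nat -> R)
    (W : R -> R[i] -> 'M[R[i]]_2) (psi : R) (dl dphi cl cphi : R -> R)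
    (r t G : R) (z : R[i]) :
  (forall j : nat, (0 < j)%N -> 0 < l j) ->
  (\sum_(1 <= j <oo) (l j)%:E < +oo)%E ->
  fundamental_solution (total_length l) (hamburger_hamiltonian l phi) W ->
  (forall t, 1 <= t -> 0 < dl t) -> (forall t, 1 <= t -> 0 < dphi t) ->
  (forall t, 1 <= t -> 0 < cl t) -> (forall t, 1 <= t -> 0 < cphi t) ->
  measurable_fun [set t : R | 1 <= t] dl ->
  measurable_fun [set t : R | 1 <= t] dphi ->
  (forall s t, 1 <= s -> s <= t -> dl t <= dl s) ->
  (forall s t, 1 <= s -> s <= t -> dphi t <= dphi s) ->
  (forall s t, 1 <= s -> s <= t -> cl t <= cl s) ->
  (forall s t, 1 <= s -> s <= t -> cphi t <= cphi s) ->
  (forall t, 1 <= t -> dphi t <= 1) -> (forall t, 1 <= t -> cphi t <= cl t) ->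
  (forall j : nat, (0 < j)%N -> l j <= dl j%:R) ->
  (forall j : nat, (0 < j)%N -> `|sin (phi j.+1 - phi j)| <= dphi j%:R) ->
  (forall N : nat, (0 < N)%N ->
     (\sum_(N.+1 <= j <oo) (l j)%:E <= (cl N%:R)%:E)%E) ->
  (forall N : nat, (0 < N)%N ->
     (\sum_(N.+1 <= j <oo) (l j * sin (phi j - psi) ^+ 2)%:E <= (cphi N%:R)%:E)%E) ->
  2 / (dl 1 * dphi 1) <= r -> 1 <= t -> g_integral dl dphi t r = G%:E ->
  cnorm z = r ->
  bounded_by (W (total_length l) z)
    (expR (9 * (Num.max G (r * Num.sqrt (cl t * cphi t)) +
                L_remainder dl dphi cl cphi t r))).
Proof.
move=> l0 loo Wf dl0 dphi0 cl0 cphi0 mdl mdphi dln dphin cln cphin dphi1 ccl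
  ldl sind tcl tcphi rge t1 GE zr.
have j1 j : (0 < j)%N -> 1 <= j%:R :> R by rewrite ler1n.
have d1 : 0 < dl 1 * dphi 1 by rewrite mulr_gt0 ?dl0 ?dphi0.
have r0 : 0 < r by apply: lt_le_trans rge; rewrite divr_gt0.
have rq : 2 <= r * dl 1 * dphi 1 by rewrite -mulrA -ler_pdivrMr.
have [N0 tN Nt] := nceil_itv t1; set N := nceil t in N0 tN Nt.
(* m may be smaller than m_index by one, when h is an integer that is not
   attained; the sum of logarithms over j < m is then only smaller. *)
have [m [/andP[m0 mN] hm nh]] : exists m : nat, [/\ (0 < m <= N)%N,
    h_set dl dphi r m%:R & (m < N)%N -> ~ h_set dl dphi r m.+1%:R].
  pose P (n : nat) := (0 < n <= N)%N && `[< h_set dl dphi r n%:R >].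
  have exP : exists n, P n.
    exists 1%N; rewrite /P N0/=; apply/asboolP; split => // s /andP[s1 s1'].
    have -> : s = 1 by apply: le_anti; rewrite s1 s1'.
    have := dphi1 1 (lexx _); have := dphi0 1 (lexx _); have := dl0 1 (lexx _); nra.
  have ubP n : P n -> (n <= N)%N by move=> /andP[/andP[]].
  case: (ex_maxnP exP ubP) => m /andP[mb /asboolP hm] mmax.
  exists m; split => // mN hm1; have := mmax m.+1.
  by rewrite /P /= mN ltnn => /(_ (asboolT hm1)).
have mh := h_set_ub r0 dl0 hm.
have mm : (m <= m_index dl dphi t r)%N by exact: le_m_index.
pose a j := dl j%:R; pose p j := dphi j%:R.
pose V n := W (partial_length l n) z.
have V0 : V 0 = 1%:M.
  by rewrite /V /partial_length big_geq//; have [] := Wf z.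
have VS j : V j.+1 = V j *m transfer z (l j.+1) (phi j.+1) by exact: hamburger_step.
have pos j : (0 < j)%N -> [/\ 0 < a j, 0 < p j, 0 < l j & l j <= a j].
  by move=> j0; split; [apply: dl0|apply: dphi0|apply: l0|apply: ldl] => //; exact: j1.
have good j : (0 < j <= m)%N -> p j <= r * a j.
  by move=> /andP[j0 jm]; apply: hm.2; rewrite j1//= ler_nat.
pose q := step_load r a p; pose b := frame_scale r a p.
pose c j := `|ln (p j / a j / (p j.+1 / a j.+1))|.
pose E1 := \sum_(1 <= j < m) (2 * ln (1 + q j) + 2^-1 * c j) + ln (1 + q m).
have bm : 1 <= b m.
  rewrite -[1]sqrtr1 ler_wsqrtr// ler_pdivlMr ?mul1r ?good ?m0 ?leqnn//.
  by have [] := pos m m0.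
have head : bounded_by (V m) (2 * b 1%N * expR E1 * 2).
  have hb : bounded_by (V m *m frame (phi m) (b m)) (2 * b 1%N * expR E1).
    rewrite /b /E1 /q -zr; rewrite -zr in r0 good.
    case: (m) m0 good => // n _ good.
    exact: head_bound r0 V0 VS pos sind good.
  rewrite -[V m]mulmx1 -(frame_coframe (phi m) (lt0r_neq0 (lt_le_trans ltr01 bm))) mulmxA.
  apply: bounded_by_mul => //; last exact: bounded_by_coframe.
  by rewrite mulr_ge0 ?expR_ge0// mulr_ge0// sqrtr_ge0.
have mid := middle_bound VS l0 _ mN head.
set E2 := 3 / 2 * \sum_(m.+1 <= j < N.+1) cnorm z * l j in mid.
set B := _ * expR E2 in mid.
have B1 : 0 <= 2 * b 1%N * expR E1 * 2 by rewrite !mulr_ge0 ?expR_ge0 ?sqrtr_ge0.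
have B0 : 0 <= B by rewrite mulr_ge0 ?expR_ge0.
set C := cl N%:R; set k := cphi N%:R.
have C0 : 0 < C by rewrite cl0 ?j1.
have k0 : 0 < k by rewrite cphi0 ?j1.
have tail n : (N <= n)%N -> bounded_by (V n)
    (B * (4 * Num.sqrt (C / k) * expR (3 * (cnorm z * Num.sqrt (C * k))))).
  move=> Nn; apply: (tail_bound (psi := psi) VS l0 B0 Nn k0 _ _ _ (mid B1)).
  - by rewrite ccl ?j1.
  - rewrite -lee_fin -sumEFin; apply: le_trans (tcl N N0).
    by apply: nneseries_lim_ge => i iN _; rewrite lee_fin ltW// l0// (leq_ltn_trans _ iN).
  - rewrite -lee_fin -sumEFin; apply: le_trans (tcphi N N0).
    apply: nneseries_lim_ge => i iN _; rewrite lee_fin mulr_ge0 ?sqr_ge0// ltW//.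
    by rewrite l0// (leq_ltn_trans _ iN).
have [_ acW _] := Wf z.
have lim := @bounded_by_limit R (fun s => W s z) (total_length l) _ (partial_length l) acW.
apply: bounded_byW (lim _ _ (cvg_partial_length l0 loo) _); last 2 first.
- move=> n; rewrite total_length_ge// andbT.
  by rewrite (_ : 0 = partial_length l 0) ?partial_length_le// /partial_length big_geq.
- by near=> n; apply: tail; near: n; exact: nbhs_infty_ge.
set A := lnplus r + lnplus (dl 1 / dphi 1).
have bA : b 1%N <= expR (2^-1 * A).
  have x0 : 0 < r * (dl 1 / dphi 1) by rewrite mulr_gt0// divr_gt0 ?dl0 ?dphi0.
  rewrite /b /frame_scale -mulrA; rewrite sqrt_expR_ln//.
  rewrite ler_expR ler_wpM2l// lnM ?posrE ?divr_gt0 ?dl0 ?dphi0//.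
  by rewrite lerD// lnplus_ge.
have kC : Num.sqrt (C / k) <= expR (2^-1 * lnplus (C / k)).
  by rewrite sqrt_expR_ln ?divr_gt0// ler_expR ler_wpM2l// lnplus_ge.
apply: (le_trans (le_expR_assemble _ _ _ _ _ bA kC)); rewrite ?sqrtr_ge0//.
rewrite ler_expR.
have load := total_load_le dl0 dphi0 dphi1 mdl mdphi dln dphin r0 rq t1 GE
  (introT andP (conj m0 mN)) mh nh.
rewrite -/N -/A -/a -/p -/q in load.
set T := \sum_(_ <= _ < _) _ in load.
(* The load of index m occurs once in E1 and twice in T. *)
have E12 : E1 + E2 <= T + 2^-1 * \sum_(1 <= j < m) c j.
  rewrite /T (@big_cat_nat _ _ _ m.+1 1 N.+1)//= big_nat_recr//= leqnn.
  have -> : E1 = \sum_(1 <= j < m) 2 * ln (1 + q j) + 2^-1 * \sum_(1 <= j < m) c j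
      + ln (1 + q m).
    by rewrite /E1 big_split/= [in RHS]mulr_sumr.
  have -> : \sum_(1 <= j < m) (if (j <= m)%N then 2 * ln (1 + q j)
      else 3 / 2 * (r * dl j%:R)) = \sum_(1 <= j < m) 2 * ln (1 + q j).
    by rewrite !big_nat; apply: eq_bigr => j /andP[_ /ltnW ->].
  have u0 : 0 <= ln (1 + q m) by rewrite ln_ge0// lerDl sqrtr_ge0.
  have E2le : E2 <= \sum_(m.+1 <= j < N.+1) (if (j <= m)%N then 2 * ln (1 + q j)
      else 3 / 2 * (r * dl j%:R)).
    rewrite /E2 mulr_sumr !big_nat; apply: ler_sum => j /andP[mj _].
    rewrite leqNgt mj/= zr ler_wpM2l// ler_wpM2l ?(ltW r0)// ldl//.
    exact: leq_trans mj.
  lra.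
have cle : \sum_(1 <= j < m) c j <= \sum_(1 <= j < m_index dl dphi t r) c j.
  by rewrite [leRHS](@big_cat_nat _ _ _ m)//= lerDl sumr_ge0// => i _; exact: normr_ge0.
have Xle : cnorm z * Num.sqrt (C * k) <= r * Num.sqrt (cl t * cphi t).
  rewrite zr ler_wpM2l ?(ltW r0)// ler_wsqrtr//.
  by rewrite ler_pM ?cln ?cphin// ltW.
have GX : G <= Num.max G (r * Num.sqrt (cl t * cphi t)) by rewrite le_max lexx.
have XX : r * Num.sqrt (cl t * cphi t) <= Num.max G (r * Num.sqrt (cl t * cphi t)).
  by rewrite le_max lexx orbT.
have X0 : 0 <= r * Num.sqrt (cl t * cphi t) by rewrite mulr_ge0 ?sqrtr_ge0// ltW.
have C_ge0 : 0 <= \sum_(1 <= j < m_index dl dphi t r) c j.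
  by rewrite sumr_ge0// => i _; exact: normr_ge0.
rewrite /L_remainder -/N -/C -/k -[\sum_(_ <= _ < _) `|ln _|]/(\sum_(1 <= j < m_index dl dphi t r) c j).
have := lnplus_ge0 r; have := lnplus_ge0 (dl 1 / dphi 1); have := lnplus_ge0 (C / k).
have := lnplus_ge0 (dl (m_index dl dphi t r)%:R / dphi (m_index dl dphi t r)%:R).
rewrite /A in load *.
move: (Num.max _ _) GX XX => M GX XX.
lra.
Unshelve. all: by end_near. Qed.

Theorem theorem2p2 (R : realType) (l phi : nat -> R)
    (l_gt0 : forall j : nat, (0 < j)%N -> 0 < l j)
    (l_summable : (\sum_(1 <= j <oo) (l j)%:E < +oo)%E)
    (W : R -> R[i] -> 'M[R[i]]_2)
    (W_fund : fundamental_solution (total_length l) (hamburger_hamiltonian l phi) W)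
    (psi : R) (dl dphi cl cphi : R -> R)
    (dl_gt0 : forall t, 1 <= t -> 0 < dl t)
    (dphi_gt0 : forall t, 1 <= t -> 0 < dphi t)
    (cl_gt0 : forall t, 1 <= t -> 0 < cl t)
    (cphi_gt0 : forall t, 1 <= t -> 0 < cphi t)
    (dl_meas : measurable_fun [set t : R | 1 <= t] dl)
    (dphi_meas : measurable_fun [set t : R | 1 <= t] dphi)
    (cl_meas : measurable_fun [set t : R | 1 <= t] cl)
    (cphi_meas : measurable_fun [set t : R | 1 <= t] cphi)
    (dl_noninc : forall s t, 1 <= s -> s <= t -> dl t <= dl s)
    (dphi_noninc : forall s t, 1 <= s -> s <= t -> dphi t <= dphi s)
    (cl_noninc : forall s t, 1 <= s -> s <= t -> cl t <= cl s)
    (cphi_noninc : forall s t, 1 <= s -> s <= t -> cphi t <= cphi s)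
    (dphi_le1 : forall t, 1 <= t -> dphi t <= 1)
    (cphi_le_cl : forall t, 1 <= t -> cphi t <= cl t)
    (l_le_dl : forall j : nat, (0 < j)%N -> l j <= dl j%:R)
    (sin_le_dphi : forall j : nat, (0 < j)%N ->
       `|sin (phi j.+1 - phi j)| <= dphi j%:R)
    (tail_le_cl : forall N : nat, (0 < N)%N ->
       (\sum_(N.+1 <= j <oo) (l j)%:E <= (cl N%:R)%:E)%E)
    (tail_le_cphi : forall N : nat, (0 < N)%N ->
       (\sum_(N.+1 <= j <oo) (l j * sin (phi j - psi) ^+ 2)%:E <= (cphi N%:R)%:E)%E)
    (r : R) (r_ge : 2 / (dl 1 * dphi 1) <= r) :
  (lne (ereal_sup [set (op_norm (W (total_length l) z))%:E
                     | z in [set z : R[i] | cnorm z = r]])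
   <= 9%:E * ereal_inf
        [set maxe (g_integral dl dphi t r) (r * Num.sqrt (cl t * cphi t))%:E
             + (L_remainder dl dphi cl cphi t r)%:E | t in [set t : R | (1 <= t)%R]])%E.
Proof.
have r0 : 0 < r by apply: lt_le_trans r_ge; rewrite divr_gt0// mulr_gt0 ?dl_gt0 ?dphi_gt0.
rewrite -lee_pdivrMl//; apply/ereal_infP => _ [t /= t1 <-]; rewrite lee_pdivrMl//.
have : (0 <= g_integral dl dphi t r)%E.
  apply: integral_ge0 => s /=; rewrite in_itv/= => /andP[s1 _].
  by rewrite lee_fin g_growth_ge0.
case GE : (g_integral dl dphi t r) => [G| |]// _; last first.
  by rewrite maxye addye// mulry gtr0_sg// mul1e leey.
rewrite -EFin_max -EFinD -EFinM; set B := 9 * _.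
have supB : (ereal_sup [set (op_norm (W (total_length l) z))%:E
    | z in [set z : R[i] | cnorm z = r]] <= (expR B)%:E)%E.
  apply/ereal_supP => _ [z zr <-]; rewrite lee_fin.
  apply: op_norm_le; first exact: expR_ge0.
  exact: (monodromy_bound (psi := psi)).
have -> : B%:E = lne (expR B)%:E by rewrite lne_EFin ?expR_gt0// expRK.
set S := ereal_sup _ in supB *.
have [S0|S0] := leP 0%E S; last by rewrite le0_lneNy ?leNye// ltW.
by rewrite lee_lne// in_itv/= ?S0 ?leey// lee_fin expR_ge0.
Qed.
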